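(* (i) Let $(G_n)$ be finite connected graphs with bounded average degree, i.e. $\sup_n 2|E(G_n)|/|V(G_n)|<\infty$. Suppose their random weak limit is a probability measure $\rho$ on rooted infinite graphs. Then $$\lim_{n\to\infty}\frac{1}{|V(G_n)|}\log\tau(G_n)=\mathbf h(\rho).$$ (ii) Let $(G_n)$ be random finite connected graphs with bounded expected average degree, i.e. $\sup_n \mathbb E\bigl[2|E(G_n)|/|V(G_n)|\bigr]<\infty$. Suppose their random weak limit is a probability measure $\rho$ on rooted infinite graphs. Then $|V(G_n)|^{-1}\log\tau(G_n)\to\mathbf h(\rho)$ in probability.
   Context: Graphs may have multiple edges and are locally finite. - $\tau(G)$ is the number of spanning trees of $G$, and $\deg_G(x)$ is the degree of $x$. - Simple random walk on $G$ moves from $x$ to $y$ with probability equal to the number of edges joining $x,y$ divided by $\deg_G(x)$. $p_k(x;G)$ is the probability that simple random walk started at $x$ is at $x$ after $k$ steps. - A rooted graph $(G,x)$ is a graph with a distinguished vertex $x$. A rooted isomorphism is a graph isomorphism taking root to root. - For a positive integer $R$, a finite rooted graph $H$, and a probability measure $\rho$ on rooted graphs, $p(R,H,\rho)$ is the probability that $H$ is rooted-isomorphic to the ball of radius $R$ about the root of a $\rho$-random rooted graph. - For a finite graph $G$, $U(G)$ is the law of $(G,x)$ with $x$ a uniformly random vertex. - $\rho$ is the random weak limit of finite graphs $(G_n)$ if $p(R,H,U(G_n))\to p(R,H,\rho)$ for every $R$ and every finite $H$. - For random finite graphs $G_n$, $\rho$ is the random weak limit if for every $R$, every finite $H$ and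 every $\epsilon>0$, $\mathbb P\bigl(|p(R,H,U(G_n))-p(R,H,\rho)|>\epsilon\bigr)\to0$. - The tree entropy of $\rho$ is $\mathbf h(\rho):=\int\bigl(\log\deg_G(x)-\sum_{k\ge1}\frac1k p_k(x;G)\bigr)\,d\rho(G,x)$. *)

(* Defs.v *)
From HB Require Import structures.
From mathcomp Require Import all_boot all_order all_algebra.
From mathcomp Require Import all_classical all_reals all_analysis.
Set Implicit Arguments. Unset Strict Implicit. Unset Printing Implicit Defensive.
Import Order.TTheory GRing.Theory Num.Theory.
Import numFieldNormedType.Exports.
Local Open Scope classical_set_scope.
Local Open Scope ring_scope.

(* Generic "multigraph given by an edge-multiplicity function".        *)
(* m x y = number of edges joining x and y.                           *)

Fixpoint within {V : Type} (m : V -> V -> nat) (r : nat) (x y : V) : Prop :=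
  match r with
  | 0 => x = y
  | r'.+1 => within m r' x y \/ exists z, within m r' x z /\ (0 < m z y)%N
  end.

(* A finite rooted (multi)graph H is given by k vertices 'I_k, a
   multiplicity function mH and a root rH.  [ball_iso m o r mH rH]: H is
   rooted-isomorphic to the ball of radius r about o (the subgraph induced
   on the vertices at distance <= r from o) in the graph m. *)
Definition ball_iso {V : Type} (m : V -> V -> nat) (o : V) (r : nat)
  (k : nat) (mH : 'I_k -> 'I_k -> nat) (rH : 'I_k) : Prop :=
  exists f : 'I_k -> V,
    [/\ injective f, f rH = o,
        (forall v, within m r o v <-> exists i, f i = v) &
        (forall i j, mH i j = m (f i) (f j))].

Record fmgraph := FGraph {
  nv : nat;
  ne : nat;
  ends : {ffun 'I_ne -> 'I_nv * 'I_nv } }.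

Definition fvert (G : fmgraph) := 'I_(nv G).
Definition fedge (G : fmgraph) := 'I_(ne G).

Definition joins (G : fmgraph) (e : 'I_(ne G)) (x y : 'I_(nv G)) : bool :=
  (ends G e == (x, y)) || (ends G e == (y, x)).

Definition loopless (G : fmgraph) : Prop :=
  forall e : 'I_(ne G), (ends G e).1 != (ends G e).2.

Definition fmult (G : fmgraph) (x y : 'I_(nv G)) : nat :=
  #|[set e : 'I_(ne G) | joins e x y]|.

Definition adjT (G : fmgraph) (T : {set 'I_(ne G)}) : rel 'I_(nv G) :=
  fun x y => [exists e in T, joins e x y].

Definition connectedT (G : fmgraph) (T : {set 'I_(ne G)}) : bool :=
  [forall x, forall y, connect (adjT T) x y].

Definition has_cycle (G : fmgraph) (T : {set 'I_(ne G)}) : Prop :=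
  exists (l : nat) (s : 'I_l.+1 -> 'I_(ne G)) (v : 'I_l.+1 -> 'I_(nv G)),
    injective s /\
    forall i : 'I_l.+1, s i \in T /\ joins (s i) (v i) (v (ordS i)).

Definition spanning_tree (G : fmgraph) (T : {set 'I_(ne G)}) : bool :=
  connectedT T && `[< ~ has_cycle T >].

Definition tau (G : fmgraph) : nat := #|[set T : {set 'I_(ne G)} | spanning_tree T]|.

Definition fconnected (G : fmgraph) : Prop :=
  (0 < nv G)%N /\ connectedT [set: 'I_(ne G)].

Definition avg_deg {R : realType} (G : fmgraph) : R :=
  (2 * ne G)%:R / (nv G)%:R.

Definition pU {R : realType} (r : nat) (k : nat) (mH : 'I_k -> 'I_k -> nat)
  (rH : 'I_k) (G : fmgraph) : R :=
  #|[set x : 'I_(nv G) | `[< ball_iso (@fmult G) x r mH rH >]]|%:R / (nv G)%:R.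

(* Countable rooted graphs (possibly infinite): vertex set nat, root 0, *)
(* given by a multiplicity function.  Only the connected component of  *)
(* the root matters.                                                   *)
Definition rgraph := nat -> nat -> nat.

Definition cyl : set (set rgraph) :=
  [set A | exists x y j, A = [set g : rgraph | g x y = j]].

Definition RG := g_sigma_algebraType cyl.

Definition valid_graph (g : rgraph) : Prop :=
  [/\ (forall x y, g x y = g y x), (forall x, g x x = 0%N) &
      (forall x, exists N, forall y, (N <= y)%N -> g x y = 0%N)].

Definition root_comp_infinite (g : rgraph) : Prop :=
  infinite_set [set v | exists r, within g r 0%N v].

Definition on_rooted_infinite {R : realType} (rho : probability RG R) : Prop :=
  rho [set g : RG | valid_graph g /\ root_comp_infinite g] = 1%E.

Definition prho {R : realType} (rho : probability RG R) (r : nat) (k : nat)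
  (mH : 'I_k -> 'I_k -> nat) (rH : 'I_k) : R :=
  fine (rho [set g : RG | ball_iso g 0%N r mH rH]).

(* degree (finite for a locally finite graph) *)
Definition deg {R : realType} (g : rgraph) (x : nat) : R :=
  limn (fun N : nat => \sum_(y < N) ((g x y)%:R : R)).

Fixpoint walk {R : realType} (g : rgraph) (x : nat) (k : nat) (y : nat) : R :=
  match k with
  | 0 => if y == x then 1 else 0
  | k'.+1 => limn (fun N : nat => \sum_(z < N) (walk g x k' z * ((g z y)%:R / deg g z) : R))
  end.

Definition ret_prob {R : realType} (g : rgraph) (k : nat) (x : nat) : R :=
  walk g x k x.

Definition tree_entropy_integrand {R : realType} (g : rgraph) : \bar R :=
  ((ln (deg g 0%N : R))%:E -
   \sum_(1 <= k <oo) ((ret_prob g k 0%N : R) / k%:R)%:E)%E.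

Definition tree_entropy {R : realType} (rho : probability RG R) : \bar R :=
  (\int[rho]_(g in [set: RG]) tree_entropy_integrand g)%E.

Definition rw_limit {R : realType} (G : nat -> fmgraph) (rho : probability RG R) : Prop :=
  forall (r : nat), (0 < r)%N ->
  forall (k : nat) (mH : 'I_k -> 'I_k -> nat) (rH : 'I_k),
    (fun n => pU r mH rH (G n) : R) @ \oo --> prho rho r mH rH.

Definition rw_limit_rand {R : realType} {d : measure_display}
  {Omega : measurableType d} (P : probability Omega R)
  (G : nat -> Omega -> fmgraph) (rho : probability RG R) : Prop :=
  forall (r : nat), (0 < r)%N ->
  forall (k : nat) (mH : 'I_k -> 'I_k -> nat) (rH : 'I_k) (eps : R), 0 < eps ->
    (fun n => fine (P [set w | eps < `| pU r mH rH (G n w) - prho rho r mH rH | ]))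
      @ \oo --> (0 : R).

(* Main.v *)
(* For a finite connected graph G, the matrix-tree theorem writes tau(G) as
   prod_x deg(x) / (2|E|) times the product of 1 - l over the eigenvalues l <> 1 of the
   simple random walk; hence
     log tau(G) = - log(2|E|) + sum_x log deg(x) - sum_(k >= 1) (sum_x p_k(x) - 1) / k.
   Divided by |V|, each term with fixed k is the mean of a bounded function of a ball of
   radius k + 1, so it converges to its integral under rho; the logarithm of the degree is
   handled the same way, because (log deg)^2 <= 4 deg has bounded mean.  The tail of the
   series is uniformly small: nonpositive eigenvalues contribute O(1/K) each, while positive
   ones are dominated by the lazy walk, whose return probabilities satisfy
   (p_k(x) - pi(x)) / deg(x) = O(k^(-1/2)) with a universal constant, so that only the
   average degree enters.  For random graphs, the deterministic case yields by contradiction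
   finitely many ball statistics that control |V|^(-1) log tau, and Markov's inequality
   bounds the average degree. *)

Require Import Defs.
From mathcomp Require Import all_boot all_order all_algebra perm.
From mathcomp Require Import all_classical all_reals all_analysis measurable_realfun.
From mathcomp Require Import spectral complex.
From mathcomp Require Import zify ring lra.
Import Order.TTheory GRing.Theory Num.Theory.
Import numFieldNormedType.Exports.
Import Defs.
Set Implicit Arguments. Unset Strict Implicit. Unset Printing Implicit Defensive.
Local Open Scope classical_set_scope.
Local Open Scope ring_scope.

(** * The matrix-tree theorem *)

(** Degrees are unbounded, so the walk is estimated relative to the degree. The rate k^(-1/2) comes
    from a one-dimensional inequality of Nash type, f(x)^4 <= 4 * dir f * ip f f for f of mean zero
    with f(x) >= 0: such an f is nonpositive somewhere, and its square has to drop to 0 along a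
    simple path, each step of which crosses at least one edge. Combined with the dissipation of the
    lazy walk it bounds the kernel divided by deg(x); summing over x brings back only the total
    degree. Weak convergence speaks only of ball statistics. Balls are therefore numbered by
    isomorphism type, a local functional becomes a sequence over the types, and averages converge as
    soon as second moments are uniformly bounded. Infinite limits force |V(G_n)| to tend to
    infinity, which removes log(2|E|)/|V| and the harmonic sum left by the eigenvalue 1. Finiteness
    of the entropy comes from tau >= 1: a nonnegative log tau bounds the partial sums of the series
    of mean return probabilities. *)

(** Multiplying by the adjugate keeps this valid over any commutative ring, where a nonzero kernel
    vector would not suffice; hence the entry equal to 1. *)
Lemma det_ker0 (R : comNzRingType) n (A : 'M[R]_n) (v : 'cV[R]_n) x :
  A *m v = 0 -> v x 0 = 1 -> \det A = 0.
Proof.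
move=> Av vx; have : (\adj A *m (A *m v)) x 0 = 0 by rewrite Av mulmx0 mxE.
by rewrite mulmxA mul_adj_mx mul_scalar_mx mxE vx mulr1.
Qed.

(** Multilinearity in all rows at once. For the Laplacian the summands of row [i] are the arcs
    leaving vertex [i], so the family of choices runs over parent assignments. *)
Lemma det_sum_rows (R : comNzRingType) (n : nat) (A : finType)
    (P : 'I_n -> pred A) (c : 'I_n -> A -> 'I_n -> R) :
  \det (\matrix_(i, j) \sum_(a | P i a) c i a j)
  = \sum_(f in family P) \det (\matrix_(i, j) c i (f i) j).
Proof.
rewrite /determinant exchange_big /=; apply: eq_bigr => s _.
rewrite -big_distrr /=; congr (_ * _).
under eq_bigr do rewrite mxE.
rewrite bigA_distr_big_dep; apply: eq_bigr => f _.
by apply: eq_bigr => i _; rewrite mxE.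
Qed.

(* [g] is a partial map, read as a parent function; iterating it stops exactly when
   the functional graph has no cycle. *)
Definition parent_mx (R : comNzRingType) (n : nat) (g : 'I_n -> option 'I_n) : 'M[R]_n :=
  \matrix_(i, j) ((i == j)%:R - (g i == Some j)%:R).

Definition stops (T : Type) (g : T -> option T) (x : T) : Prop :=
  exists k, iter k (obind g) (Some x) = None.

Lemma stops_parent (T : Type) (g : T -> option T) x y :
  g x = Some y -> stops g x <-> stops g y.
Proof.
move=> gxy; split=> -[k]; last by move=> yk; exists k.+1; rewrite iterSr /= gxy.
by case: k => [//|k]; rewrite iterSr /= gxy => ?; exists k.
Qed.

(** The height is the least number of iterations after which [g] stops. It serves as induction
    measure wherever an arborescence is climbed towards its root. *)
Lemma height_exists (T : Type) (g : T -> option T) : (forall x, stops g x) ->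
  exists h : T -> nat, forall x y, g x = Some y -> h x = (h y).+1.
Proof.
move=> gS; have gS' x : exists k, ~~ isSome (iter k (obind g) (Some x)).
  by have [k kx] := gS x; exists k; rewrite kx.
exists (fun x => ex_minn (gS' x)) => x y gxy.
case: ex_minnP => m mx mmin; case: ex_minnP => p py pmin.
case: m mx mmin => [//|m]; rewrite iterSr /= gxy => my mmin.
apply/eqP; rewrite eqSS eqn_leq; apply/andP; split; last exact: pmin.
by rewrite -ltnS; apply: mmin; rewrite iterSr /= gxy.
Qed.

(** Only the identity contributes. Among the points moved by another permutation [s], take [i] of
    least height: a nonzero entry at [(i, s i)] would make [s i] the parent of [i], which is lower
    and, by injectivity, also moved. *)
Lemma det_parent_stops (R : comNzRingType) (n : nat) (g : 'I_n -> option 'I_n) :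
  (forall x, stops g x) -> \det (parent_mx R g) = 1.
Proof.
move=> /height_exists[h hg].
have ng i : (g i == Some i) = false.
  by apply/negP => /eqP /hg /n_Sn.
rewrite /determinant (bigD1 (1%g : 'S_n)) //= [X in _ + X]big1 ?addr0.
  rewrite odd_perm1 expr0 mul1r big1 // => i _.
  by rewrite mxE perm1 eqxx ng subr0.
move=> s s1; suff [i si] : exists i, parent_mx R g i (s i) = 0.
  by rewrite (bigD1 i) //= si mul0r mulr0.
have [i0 mi0] : exists i, s i != i.
  apply/existsP; apply: contraNT s1; rewrite negb_exists => /forallP sid.
  by apply/eqP/permP => i; rewrite perm1; apply/eqP; rewrite -[_ == _]negbK sid.
case: (@arg_minnP _ i0 (fun i => s i != i) h mi0) => i mi imin.
exists i; rewrite mxE eq_sym (negPf mi) sub0r; case: eqP => [gi|_]; last by rewrite oppr0.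
have : s (s i) != s i by apply: contraNneq mi => /perm_inj ->.
by move=> /imin; rewrite (hg _ _ gi) ltnn.
Qed.

(** The indicator of the points that never stop lies in the kernel, because a point stops exactly
    when its parent does. *)
Lemma det_parent_cycle (R : comNzRingType) (n : nat) (g : 'I_n -> option 'I_n) x :
  ~ stops g x -> \det (parent_mx R g) = 0.
Proof.
move=> nx; pose v : 'cV[R]_n := \col_i (`[< ~ stops g i >])%:R.
have Mv : parent_mx R g *m v = 0.
  apply/matrixP => i j; rewrite !mxE.
  under eq_bigr do rewrite !mxE mulrBl.
  rewrite sumrB (bigD1 i) //= eqxx mul1r big1 ?addr0; last first.
    by move=> k ki; rewrite eq_sym (negPf ki) mul0r.
  case gi: (g i) => [y|]; last first.
    rewrite big1 ?subr0; last by move=> k _; rewrite mul0r.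
    by case: asboolP => // -[]; exists 1%N; rewrite /= gi.
  rewrite (bigD1 y) //= eqxx mul1r big1 ?addr0.
    rewrite (_ : `[< ~ stops g i >] = `[< ~ stops g y >]) ?subrr //.
    by apply: asbool_equiv_eq; rewrite (stops_parent gi).
  by move=> k ky; case: eqP => [[yk]|_]; [rewrite yk eqxx in ky | rewrite mul0r].
by apply: (det_ker0 (x := x) Mv); rewrite mxE asboolT.
Qed.

Lemma card_set_bool (T : finType) (P : pred T) : #|[set x | P x]| = #|P|.
Proof. by apply: eq_card => x; rewrite -[RHS]asboolb. Qed.

Section Arborescences.
Variable G : fmgraph.
Local Notation V := 'I_(nv G).
Local Notation E := 'I_(ne G).
Implicit Types (e : E) (F : {ffun V -> option (E * V)}).

Definition gdeg (v : V) : nat := \sum_w fmult v w.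

Definition laplacian (R : comNzRingType) : 'M[R]_(nv G) :=
  \matrix_(v, w) ((v == w)%:R * (gdeg v)%:R - (fmult v w)%:R).

(** With [u = delta_mx 0 r] the determinant is the principal cofactor at [r]. Replacing the row
    instead of deleting it keeps all matrices indexed by the vertices. *)
Definition set_row (R : comNzRingType) n (A : 'M[R]_n) (r : 'I_n) (u : 'rV[R]_n) : 'M[R]_n :=
  \matrix_(v, w) if v == r then u 0 w else A v w.

(** An arc records the edge besides its endpoint, so that parallel edges count as different
    choices. *)
Definition rooted_arc (r v : V) : pred (option (E * V)) := fun a =>
  if v == r then a == None else if a is Some (e, u) then joins e v u else false.

Definition parent F v := omap snd (F v).

Definition arborescence (r : V) F : bool :=
  (F \in family (rooted_arc r)) && [forall v, `[< stops (parent F) v >]].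

Lemma fmultE (v w : V) : fmult v w = (\sum_e joins e v w)%N.
Proof.
rewrite /fmult card_set_bool -sum1_card big_mkcond; apply: eq_bigr => e _.
by rewrite unfold_in; case: ifP.
Qed.

Lemma sum_rooted_arc (R : comNzRingType) (r v w : V) :
  \sum_(a | rooted_arc r v a) ((v == w)%:R - (omap snd a == Some w)%:R)
  = set_row (laplacian R) r (delta_mx 0 r) v w.
Proof.
rewrite /set_row mxE /rooted_arc; case: (eqVneq v r) => [->|vr].
  by rewrite big_pred1_eq /= subr0 mxE eqxx eq_sym.
rewrite (reindex_omap (Some : E * V -> _) id) //=; last by case.
rewrite (eq_bigl (fun p : E * V => joins p.1 v p.2)); last first.
  by move=> -[e u] /=; rewrite eqxx andbT.
rewrite -(pair_big_dep xpredT (fun e u => joins e v u)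
  (fun e u => (v == w)%:R - (Some u == Some w)%:R)) /= mxE.
under eq_bigr do rewrite big_mkcond /=.
rewrite exchange_big /=.
transitivity (\sum_u (fmult v u)%:R * ((v == w)%:R - (u == w)%:R) : R).
  apply: eq_bigr => u _; rewrite fmultE natr_sum mulr_suml; apply: eq_bigr => e _.
  by rewrite (inj_eq Some_inj); case: ifP; rewrite ?mul1r ?mul0r.
under eq_bigr do rewrite mulrBr.
rewrite sumrB -mulr_suml -natr_sum mulrC; congr (_ - _).
rewrite (bigD1 w) //= eqxx mulr1 big1 ?addr0 // => u uw.
by rewrite (negPf uw) mulr0.
Qed.

Lemma det_rooted_laplacian (R : comNzRingType) (r : V) :
  \det (set_row (laplacian R) r (delta_mx 0 r)) = #|arborescence r|%:R.
Proof.
pose c (v : V) (a : option (E * V)) (w : V) : R :=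
  (v == w)%:R - (omap snd a == Some w)%:R.
have -> : set_row (laplacian R) r (delta_mx 0 r)
          = \matrix_(v, w) \sum_(a | rooted_arc r v a) c v a w.
  by apply/matrixP => v w; rewrite [RHS]mxE sum_rooted_arc.
rewrite det_sum_rows -sum1_card natr_sum big_mkcond [RHS]big_mkcond /=.
apply: eq_bigr => F _; rewrite unfold_in /arborescence; case: (F \in _) => //=.
rewrite (_ : matrix_of_fun _ _ = parent_mx R (parent F)); last first.
  by apply/matrixP => v w; rewrite !mxE.
case: ifPn => [/forallP sF|].
  by rewrite det_parent_stops // => x; apply/asboolP.
by rewrite negb_forall => /existsP[x /asboolP]; exact: det_parent_cycle.
Qed.
End Arborescences.

(** * Bijection between arborescences with a given root and spanning trees *)

Section SpanningTrees.
Variable G : fmgraph.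
Local Notation V := 'I_(nv G).
Local Notation E := 'I_(ne G).
Implicit Types (e : E) (F : {ffun V -> option (E * V)}) (T : {set E}).

Lemma joins_sym e (a b : V) : joins e a b = joins e b a.
Proof. by rewrite /joins orbC. Qed.

Lemma joins_eq e (a b c d : V) : joins e a b -> joins e c d ->
  (a = c /\ b = d) \/ (a = d /\ b = c).
Proof.
by rewrite /joins => /orP[]/eqP -> /orP[]/eqP[-> ->]; [left|right|right|left].
Qed.

Lemma adjT_sym T : symmetric (adjT T).
Proof. by move=> x y; apply: eq_existsb => e; rewrite joins_sym. Qed.

Definition arb_edges F : {set E} := finset (fun e => [exists v, omap fst (F v) == Some e]).

Lemma arb_edgesP F e : reflect (exists v u, F v = Some (e, u)) (e \in arb_edges F).
Proof.
rewrite finset.in_set; apply: (iffP existsP) => [[v]|[v [u Fv]]]; last by exists v; rewrite Fv.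
by case Fv: (F v) => [[e' u]|] //= /eqP[<-]; exists v, u.
Qed.

Section Fixed.
Variables (r : V) (F : {ffun V -> option (E * V)}).
Hypothesis arbF : arborescence r F.

Lemma arb_root : F r = None.
Proof.
case/andP: arbF => /familyP/(_ r); rewrite unfold_in /rooted_arc eqxx.
by move=> /eqP.
Qed.

Lemma arb_joins v e u : F v = Some (e, u) -> joins e v u.
Proof.
move=> Fv; case/andP: arbF => /familyP/(_ v); rewrite unfold_in /rooted_arc Fv.
by case: eqP.
Qed.

Lemma arb_nonroot v : v != r -> exists e u, F v = Some (e, u).
Proof.
move=> vr; case/andP: arbF => /familyP/(_ v); rewrite unfold_in /rooted_arc (negPf vr).
by case: (F v) => // -[e u] _ _; exists e, u.
Qed.

Lemma arb_height : exists h : V -> nat,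
  forall v e u, F v = Some (e, u) -> h v = (h u).+1.
Proof.
have [|h hP] := @height_exists _ (parent F).
  by move=> v; apply/asboolP; case/andP: arbF => _ /forallP.
by exists h => v e u Fv; apply: hP; rewrite /parent Fv.
Qed.

Lemma arb_connected : connectedT (arb_edges F).
Proof.
have [h hP] := arb_height.
have cr v : connect (adjT (arb_edges F)) v r.
  have [n] := ubnP (h v); elim: n v => // n IH v hv.
  have [->//|/arb_nonroot[e [u Fv]]] := eqVneq v r.
  apply: connect_trans (IH u _); last by rewrite -ltnS -(hP _ _ _ Fv).
  apply: connect1; apply/existsP; exists e; rewrite (arb_joins Fv) andbT.
  by apply/arb_edgesP; exists v, u.
apply/forallP => x; apply/forallP => y.
by apply: connect_trans (cr x) _; rewrite (sym_connect_sym (@adjT_sym _)).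
Qed.

(* In a closed trail, both edges at a vertex of maximal height lead to its parent,
   so they coincide. *)
Lemma arb_acyclic : ~ has_cycle (arb_edges F).
Proof.
have [h hP] := arb_height; move=> [l [s [v [sI sP]]]].
have child i a b : joins (s i) a b -> (h b <= h a)%N -> F a = Some (s i, b).
  move=> jab hab; have [/arb_edgesP[c [d Fc]] _] := sP i.
  have [[ac bd]|[ad bc]] := joins_eq jab (arb_joins Fc); first by rewrite ac Fc bd.
  by move: hab; rewrite ad bc (hP _ _ _ Fc) ltnn.
case: (@arg_maxnP _ ord0 xpredT (h \o v) isT) => i _ imax.
pose j := ord_pred i; have ji : ordS j = i by rewrite ord_predK.
have F1 : F (v i) = Some (s i, v (ordS i)).
  by apply: child; [have [] := sP i | exact: imax].
have F2 : F (v i) = Some (s j, v j).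
  apply: child; last exact: imax.
  by have [_] := sP j; rewrite ji joins_sym.
have /sI ij : s i = s j by move: F1; rewrite F2 => -[].
by have := hP _ _ _ F2; rewrite -ij; lia.
Qed.

End Fixed.

(** Induction on the height in [F]. The edge from [v] to its parent [u] is an arc of [F'] too,
    leaving either [v] or [u]; in the second case the induction hypothesis at [u] makes [v] the
    parent of [u] in [F] as well, against the heights. *)
Lemma arb_edges_inj (r : V) F F' : arborescence r F -> arborescence r F' ->
  arb_edges F = arb_edges F' -> F = F'.
Proof.
move=> aF aF' FF'; have [h hP] := arb_height aF.
apply/ffunP => v; have [n] := ubnP (h v); elim: n v => // n IH v hv.
have [->|vr] := eqVneq v r; first by rewrite (arb_root aF) (arb_root aF').
have [e [u Fv]] := arb_nonroot aF vr.
have /arb_edgesP[c [d F'c]] : e \in arb_edges F' by rewrite -FF'; apply/arb_edgesP; exists v, u.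
have [[vc ud]|[vd uc]] := joins_eq (arb_joins aF Fv) (arb_joins aF' F'c).
  by rewrite Fv vc F'c ud.
have Fu : F u = Some (e, v).
  by rewrite IH ?uc ?F'c ?vd // -uc -ltnS -(hP _ _ _ Fv).
have := hP _ _ _ Fv; rewrite (hP _ _ _ Fu).
lia.
Qed.

End SpanningTrees.

(** [d] is the distance to [r], and [u] is the first vertex of a shortest path. *)
Lemma descent_exists (V : finType) (e : rel V) (r : V) : (forall v, connect e v r) ->
  exists d : V -> nat, forall v, v != r -> exists2 u, e v u & (d u < d v)%N.
Proof.
move=> er; pose P v k := [exists p : k.-tuple V, path e v p && (last v p == r)].
have PE v : exists k, P v k.
  have /connectP[p vp rp] := er v; exists (size p).
  by apply/existsP; exists (in_tuple p); rewrite vp /= -rp.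
exists (fun v => ex_minn (PE v)) => v vr.
case: ex_minnP => k /existsP[[[|u p] /= sp]]; first by rewrite (negPf vr).
move=> /andP[/andP[evu up] lp] _; exists u => //.
case: ex_minnP => m _ /(_ (size p)); rewrite -(eqP sp) ltnS; apply.
by apply/existsP; exists (in_tuple p); rewrite up.
Qed.

Section SpanningTreeArborescence.
Variable G : fmgraph.
Local Notation V := 'I_(nv G).
Local Notation E := 'I_(ne G).
Implicit Types (e : E) (F : {ffun V -> option (E * V)}) (T : {set E}).

Lemma joins_ends e : exists a b : V, joins e a b.
Proof. by case ee: (ends G e) => [a b]; exists a, b; rewrite /joins ee eqxx. Qed.

(** A simple path in [T'] between the ends of [e] is closed up by [e]; if [e] is a loop the path is
    empty and the cycle has length one. Edges of the path are distinct because its vertices are. *)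
Lemma cycle_of_chord T T' e : {subset T' <= T} -> connectedT T' -> e \in T ->
  e \notin T' -> has_cycle T.
Proof.
move=> T'T cT' eT eT'; have [a [b jab]] := joins_ends e.
have /forallP/(_ a)/forallP/(_ b)/connectP[p0 ap0 bp0] := cT'.
case/shortenP: ap0 bp0 => p ap up _ bp {p0}.
pose l := size p; pose v (i : 'I_l.+1) := nth a (a :: p) i.
have step i : (i < l)%N ->
    exists f : E, (f \in T') && joins f (nth a (a :: p) i) (nth a (a :: p) i.+1).
  by move=> il; have /(pathP a)/(_ i il)/existsP := ap.
have [s sP] : exists s : nat -> E, forall i, (i < l)%N ->
    (s i \in T') && joins (s i) (nth a (a :: p) i) (nth a (a :: p) i.+1).
  exists (fun i => if pselect (i < l)%N is left il then projT1 (cid (step i il)) else e).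
  by move=> i il; case: pselect => // il'; case: cid.
have lb : nth a (a :: p) l = b by rewrite bp; exact: (nth_last a (a :: p)).
exists l, (fun i : 'I_l.+1 => if (i < l)%N then s i else e), v; split.
  move=> i j; case: ifPn => il; case: ifPn => jl.
  - move=> sij; have /andP[_ ji] := sP i il; have /andP[_ jj] := sP j jl.
    rewrite sij in ji; apply/val_inj/eqP => /=.
    have nu k m : (k <= l)%N -> (m <= l)%N -> nth a (a :: p) k = nth a (a :: p) m -> k = m.
      by move=> kl ml /eqP; rewrite nth_uniq //= => /eqP.
    case: (joins_eq ji jj) => -[e1 e2].
      by apply/eqP; apply: nu e1; exact: ltnW.
    by have := nu _ _ (ltnW il) jl e1; have := nu _ _ il (ltnW jl) e2; lia.
  - by move=> sie; have /andP[] := sP i il; rewrite sie (negPf eT').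
  - by move=> sje; have /andP[] := sP j jl; rewrite -sje (negPf eT').
  - move=> _; apply/val_inj => /=; move: (ltn_ord i) (ltn_ord j) il jl; lia.
move=> i; case: ifPn => il.
  have /andP[siT ji] := sP i il; split; first exact: T'T.
  by rewrite /v /= modn_small.
split => //; have il' : i = l :> nat by move: (ltn_ord i) il; lia.
by rewrite /v /= il' modnn lb /= joins_sym.
Qed.

(** Every vertex other than [r] chooses an edge of [T] that brings it closer to [r]. The chosen
    edges already connect the graph, so one further edge of [T] would close a cycle. *)
Lemma arb_edges_surj (r : V) T : spanning_tree T ->
  exists2 F, arborescence r F & arb_edges F = T.
Proof.
move=> /andP[cT /asboolP aT].
have [d dP] : exists d : V -> nat, forall v, v != r -> exists2 u, adjT T v u & (d u < d v)%N.
  by apply: descent_exists => v; have /forallP/(_ v)/forallP/(_ r) := cT.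
pose F : {ffun V -> option (E * V)} := [ffun v => if v == r then None else
  [pick a : E * V | [&& a.1 \in T, joins a.1 v a.2 & (d a.2 < d v)%N]]].
have FS v e u : F v = Some (e, u) -> [/\ e \in T, joins e v u & (d u < d v)%N].
  rewrite ffunE; case: eqP => // _; case: pickP => // -[e' u'] /and3P[? ? ?] [<- <-].
  by [].
have FN v : v != r -> exists e u, F v = Some (e, u).
  move=> vr; rewrite ffunE (negPf vr); case: pickP => [[e u] _|]; first by exists e, u.
  have [u /existsP[e /andP[eT jvu]] duv] := dP v vr.
  by move=> /(_ (e, u)); rewrite eT jvu duv.
have aF : arborescence r F.
  apply/andP; split.
    apply/familyP => v; rewrite unfold_in /rooted_arc; case: eqVneq => [->|vr].
      by rewrite ffunE eqxx.
    have [e [u Fv]] := FN v vr; rewrite Fv.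
    by have [] := FS _ _ _ Fv.
  apply/forallP => v; apply/asboolP.
  have [n] := ubnP (d v); elim: n v => // n IH v dv.
  case Fv: (F v) => [[e u]|]; last by exists 1%N; rewrite /= /parent Fv.
  have [_ _ duv] := FS _ _ _ Fv.
  apply/(@stops_parent _ _ _ u); first by rewrite /parent Fv.
  by apply: IH; apply: leq_trans duv _.
have FT : {subset arb_edges F <= T}.
  by move=> e /arb_edgesP[v [u /FS[]]].
exists F => //; apply/eqP; rewrite finset.eqEsubset; apply/andP; split.
  by apply/fintype.subsetP.
apply/fintype.subsetP => e eT; apply: contrapT => /negP eF; apply: aT.
by apply: (cycle_of_chord FT _ eT eF); exact: (arb_connected aF).
Qed.

Lemma card_arborescence (r : V) : #|@arborescence G r| = tau G.
Proof.
rewrite /tau card_set_bool -(@card_in_imset _ _ (@arb_edges G)); last first.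
  by move=> F F' aF aF'; apply: arb_edges_inj aF aF'.
apply: eq_card => T; apply/imsetP/idP => [[F aF ->]|/(arb_edges_surj r)[F aF <-]].
  apply/andP; split; first exact: (arb_connected aF).
  by apply/asboolP; exact: (arb_acyclic aF).
by exists F.
Qed.

Lemma matrix_tree (R : comNzRingType) (r : V) :
  \det (set_row (laplacian G R) r (delta_mx 0 r)) = (tau G)%:R.
Proof. by rewrite det_rooted_laplacian card_arborescence. Qed.

End SpanningTreeArborescence.

(** * Determinants and spectrum of the walk *)

Lemma det_set_row1 (R : comNzRingType) n (r : 'I_n) (u : 'rV[R]_n) :
  \det (set_row 1%:M r u) = u 0 r.
Proof.
rewrite /determinant (bigD1 (1%g : {perm 'I_n})) //= [X in _ + X]big1 ?addr0.
  rewrite odd_perm1 expr0 mul1r (bigD1 r) //= mxE eqxx perm1 big1 ?mulr1 // => i ir.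
  by rewrite !mxE (negPf ir) perm1 eqxx.
move=> s s1; suff [i ir si] : exists2 i, i != r & s i != i.
  by rewrite (bigD1 i) //= !mxE (negPf ir) eq_sym (negPf si) mul0r mulr0.
have [i0 mi0] : exists i, s i != i.
  apply/existsP; apply: contraNT s1; rewrite negb_exists => /forallP sid.
  by apply/eqP/permP => i; rewrite perm1; apply/eqP; rewrite -[_ == _]negbK sid.
have [i0r|] := eqVneq i0 r; last by exists i0.
exists (s i0); first by rewrite -i0r.
by apply: contraNneq mi0 => /perm_inj ->.
Qed.

(** The determinant is linear in row [r], and replacing that row by [u - t *: delta_mx 0 r], of sum
    zero, puts the all-ones vector into the kernel. *)
Lemma det_set_row_sum (R : comNzRingType) n (A : 'M[R]_n) (r : 'I_n) (u : 'rV[R]_n) :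
  (forall v, \sum_w A v w = 0) ->
  \det (set_row A r u) = (\sum_w u 0 w) * \det (set_row A r (delta_mx 0 r)).
Proof.
move=> A0; set t := \sum_w _.
rewrite (@determinant_multilinear _ _ _ (set_row A r (delta_mx 0 r))
  (set_row A r (u - t *: delta_mx 0 r)) r t 1).
- rewrite [X in _ + 1 * X](@det_ker0 _ _ _ (const_mx 1) r) ?mxE //.
    by rewrite mulr0 addr0.
  apply/matrixP => v j; rewrite !mxE; under eq_bigr do rewrite !mxE mulr1.
  case: eqP => // _; rewrite sumrB -/t (bigD1 r) //= eqxx mulr1.
  rewrite big1 ?addr0 ?subrr // => i ir.
  by rewrite (negPf ir) mulr0.
- by apply/rowP => w; rewrite !mxE eqxx; ring.
- by apply/matrixP => i j; rewrite !mxE eq_sym (negPf (neq_lift _ _)).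
- by apply/matrixP => i j; rewrite !mxE eq_sym (negPf (neq_lift _ _)).
Qed.

(** Two row operations of determinant 1. [W] adds all rows to row [r], which becomes [u] since the
    columns of [A] sum to 0 and [w] sums to 1; [Z] then subtracts [w i 0] times row [r] from every
    other row [i]. *)
Lemma det_rank1_update (R : comNzRingType) n (A : 'M[R]_n) (r : 'I_n)
    (w : 'cV[R]_n) (u : 'rV[R]_n) :
  (forall j, \sum_i A i j = 0) -> \sum_i w i 0 = 1 ->
  \det (A + w *m u) = \det (set_row A r u).
Proof.
move=> A0 w1.
pose Z := (set_row 1%:M r (\row_j (if j == r then 1 else - w j 0)))^T.
pose W := set_row 1%:M r (const_mx 1 : 'rV[R]_n).
have WA : W *m (A + w *m u) = set_row (A + w *m u) r u.
  apply/matrixP => i j; rewrite mxE [RHS]mxE; case: eqP => [->|/eqP ir].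
    under eq_bigr do rewrite mxE eqxx mxE mul1r !mxE big_ord1.
    by rewrite big_split /= A0 add0r -mulr_suml w1 mul1r ord1.
  rewrite (bigD1 i) //= mxE (negPf ir) mxE eqxx mul1r big1 ?addr0 // => k ki.
  by rewrite mxE (negPf ir) mxE eq_sym (negPf ki) mul0r.
have ZWA : Z *m set_row (A + w *m u) r u = set_row A r u.
  apply/matrixP => i j; rewrite mxE [RHS]mxE (bigD1 r) //= [in X in X * _]mxE.
  rewrite mxE eqxx mxE mxE eqxx; case: eqP => [->|/eqP ir].
    rewrite big1 ?addr0 ?mul1r // => k kr.
    by rewrite !mxE !(negPf kr) mul0r.
  rewrite (bigD1 i) //= big1 ?addr0.
    by rewrite !mxE (negPf ir) eqxx mul1r big_ord1; ring.
  by move=> k /andP[kr ki]; rewrite !mxE (negPf kr) (negPf ki) mul0r.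
have := congr1 determinant ZWA; rewrite -WA !det_mulmx /Z /W det_tr !det_set_row1.
by rewrite !mxE eqxx !mul1r => ->.
Qed.

(** The Hermitian spectral theorem over the complex numbers yields a real diagonal; real matrices
    that are similar over the complex numbers are similar by a real matrix. *)
Lemma symmetric_diagonalizable (R : rcfType) n (A : 'M[R]_n) : A^T = A ->
  exists (S : 'M[R]_n) (l : 'rV[R]_n), S \in unitmx /\ A *m S = S *m diag_mx l.
Proof.
move=> AT; pose f := real_complex R; pose Ac := map_mx f A.
have fr x : f x \is Num.real by rewrite complex_real.
have Areal : Ac \is a mxOver Num.real by apply/mxOverP => i j; rewrite mxE.
have Ah : Ac \is hermsymmx.
  apply: realsym_hermsym => //.
  by apply/is_hermitianmxP; rewrite expr0 scale1r map_mx_id // /Ac map_trmx AT.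
have /hermitian_normalmx/orthomx_spectralP AE := Ah.
have sr := hermitian_spectral_diag_real Ah.
pose l : 'rV[R]_n := \row_j complex.Re (spectral_diag Ac 0 j).
have lE : spectral_diag Ac = map_mx f l.
  apply/rowP => j; rewrite !mxE; have /mxOverP/(_ 0 j) := sr.
  by move=> /RRe_real; rewrite /f => ->.
have : similar_in unitmx Ac (map_mx f (diag_mx l)).
  exists (spectralmx Ac); first exact: spectral_unit.
  apply/similarP; first exact: spectral_unit.
  rewrite map_diag_mx -lE {2}AE !mulmxA mulmxV ?spectral_unit //.
  by rewrite mul1mx.
move=> /real_similar[//||P /andP[Pr Pu] /similarP].
  by apply/mxOverP => i j; rewrite mxE.
pose P0 := map_mx (@complex.Re R) P.
have PE : P = map_mx f P0.
  by apply/matrixP => i j; rewrite !mxE /f RRe_real //; have /mxOverP := Pr; exact.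
have P0u : P0 \in unitmx by rewrite -(map_unitmx f) -PE.
rewrite PE => /(_ (etrans (map_unitmx _ _) P0u)); rewrite -!map_mxM => /map_mx_inj PA.
exists (invmx P0), l; split; first by rewrite unitmx_inv.
by rewrite -[LHS](mulKmx P0u) [P0 *m (A *m _)]mulmxA PA -!mulmxA mulmxV // mulmx1.
Qed.

Lemma exprD_ortho (R : pzRingType) (X P : R) k : X * P = 0 -> P * X = 0 -> P * P = P ->
  (X + P) ^+ k.+1 = X ^+ k.+1 + P.
Proof.
move=> XP PX PP; elim: k => [|k IH]; first by rewrite !expr1.
have PXk : P * X ^+ k.+1 = 0 by rewrite exprS mulrA PX mul0r.
by rewrite exprS IH mulrDl !mulrDr -exprS XP addr0 PP PXk add0r.
Qed.

Lemma scale_mulmxl (R : comPzRingType) n a (A B : 'M[R]_n) : (a *: A) * B = a *: (A * B).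
Proof. by rewrite -!mulmxE -scalemxAl. Qed.

Lemma scale_mulmxr (R : comPzRingType) n a (A B : 'M[R]_n) : A * (a *: B) = a *: (A * B).
Proof. by rewrite -!mulmxE -scalemxAr. Qed.

Lemma scalemx_expr (R : comPzRingType) n a (A : 'M[R]_n) k : (a *: A) ^+ k = a ^+ k *: A ^+ k.
Proof.
elim: k => [|k IH]; first by rewrite !expr0 scale1r.
by rewrite !exprS IH scale_mulmxl scale_mulmxr scalerA.
Qed.

Section DiagonalizableTrace.
Variables (R : fieldType) (n : nat) (A S : 'M[R]_n) (l : 'rV[R]_n).
Hypotheses (Su : S \in unitmx) (AS : A *m S = S *m diag_mx l).

Lemma diagonalizable_expr k : A ^+ k *m S = S *m diag_mx (\row_j l 0 j ^+ k).
Proof.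
elim: k => [|k IH].
  rewrite expr0 mul1mx (_ : diag_mx _ = 1%:M) ?mulmx1 //.
  by apply/matrixP => i j; rewrite !mxE expr0.
rewrite exprSr -mulmxE -mulmxA AS mulmxA IH -mulmxA mulmx_diag.
by congr (_ *m diag_mx _); apply/rowP => j; rewrite !mxE exprSr.
Qed.

Lemma diagonalizable_tr : \tr A = \sum_i l 0 i.
Proof.
have -> : A = S *m diag_mx l *m invmx S by rewrite -AS mulmxK.
by rewrite mxtrace_mulC mulmxA mulVmx // mul1mx mxtrace_diag.
Qed.

Lemma diagonalizable_det : \det A = \prod_i l 0 i.
Proof.
have -> : A = S *m diag_mx l *m invmx S by rewrite -AS mulmxK.
rewrite !det_mulmx det_inv det_diag mulrAC mulfV ?mul1r //.
by rewrite -unitfE -unitmxE.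
Qed.
End DiagonalizableTrace.

Lemma half_double_sub (R : numFieldType) n (A : 'M[R]_n) : 2^-1 *: (A + A) - A = 0.
Proof. by apply/matrixP => i j; rewrite !mxE; field. Qed.

(** * The reversible walk of a finite network, its stationary projection and its energy form *)

Section Network.
Variables (R : realType) (n : nat) (m : 'I_n -> 'I_n -> nat).
Local Notation V := 'I_n.

Definition ndeg (v : V) : R := (\sum_w m v w)%:R.
Definition nvol : R := \sum_v ndeg v.
Definition walk_mx : 'M[R]_n := \matrix_(v, w) ((m v w)%:R / ndeg v).
(** The projection onto constants given by the stationary law. Subtracting it from [walk_mx], or
    from the lazy walk in [lazy_mx], turns the eigenvalue 1 of the constants into 0. *)
Definition stat_mx : 'M[R]_n := \matrix_(v, w) (ndeg w / nvol).
Definition lazy_mx : 'M[R]_n := 2^-1 *: (1 + walk_mx) - stat_mx.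

Hypothesis msym : forall v w, m v w = m w v.
Hypothesis mconn : forall v w, connect (fun a b => (0 < m a b)%N) v w.
Hypothesis dpos : forall v, 0 < ndeg v.

Lemma ndegE v : ndeg v = \sum_w (m v w)%:R.
Proof. by rewrite /ndeg natr_sum. Qed.

Lemma nvol_gt0 (v : V) : 0 < nvol.
Proof.
rewrite /nvol (bigD1 v) //= ltr_pwDl //.
by apply: sumr_ge0 => w _; exact: ltW.
Qed.

Let dn0 v : ndeg v != 0. Proof. exact: lt0r_neq0. Qed.
Let vn0 (v : V) : nvol != 0. Proof. exact: lt0r_neq0 (nvol_gt0 v). Qed.

Lemma walk_mx_sum v : \sum_w walk_mx v w = 1.
Proof.
by under eq_bigr do rewrite mxE; rewrite -mulr_suml -ndegE divff.
Qed.

Lemma walk_stat_mx : walk_mx * stat_mx = stat_mx.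
Proof.
apply/matrixP => v w; rewrite -mulmxE mxE.
under eq_bigr do rewrite [stat_mx _ _]mxE.
by rewrite -mulr_suml walk_mx_sum mul1r mxE.
Qed.

Lemma stat_walk_mx : stat_mx * walk_mx = stat_mx.
Proof.
apply/matrixP => v w; rewrite -mulmxE mxE.
under eq_bigr => u _ do rewrite !mxE mulrC mulrA divfK // msym.
by rewrite -mulr_suml -ndegE mxE.
Qed.

Lemma stat_mx_sq : stat_mx * stat_mx = stat_mx.
Proof.
apply/matrixP => v w; rewrite -mulmxE mxE.
under eq_bigr => u _ do rewrite !mxE.
by rewrite -mulr_suml -mulr_suml divff ?mul1r ?mxE //; exact: vn0 v.
Qed.

Lemma tr_stat_mx (v : V) : \tr stat_mx = 1.
Proof.
rewrite /mxtrace; under eq_bigr do rewrite mxE.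
by rewrite -mulr_suml divff //; exact: vn0 v.
Qed.

(** Powers split as [(Q - P) ^+ k.+1 + P] with a projection [P] of trace 1. The exponent must be
    positive: for exponent 0 the two traces agree. *)
Lemma tr_walk_mx_expr (v : V) k :
  \tr (walk_mx ^+ k.+1) = \tr ((walk_mx - stat_mx) ^+ k.+1) + 1.
Proof.
rewrite -{1}(subrK stat_mx walk_mx) exprD_ortho ?mxtraceD ?(tr_stat_mx v) //.
- by rewrite mulrBl walk_stat_mx stat_mx_sq subrr.
- by rewrite mulrBr stat_walk_mx stat_mx_sq subrr.
- exact: stat_mx_sq.
Qed.

Lemma lazy_stat_mx : lazy_mx * stat_mx = 0.
Proof.
rewrite mulrBl scale_mulmxl mulrDl mul1r walk_stat_mx stat_mx_sq.
exact: half_double_sub.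
Qed.

Lemma stat_lazy_mx : stat_mx * lazy_mx = 0.
Proof.
rewrite mulrBr scale_mulmxr mulrDr mulr1 stat_walk_mx stat_mx_sq.
exact: half_double_sub.
Qed.

(** On constants the matrix on the left acts as 1/2, while [lazy_mx] acts as 0; this accounts for
    the additional power of 1/2. *)
Lemma tr_half_mx_expr (v : V) k :
  \tr ((2^-1 *: (1 + (walk_mx - stat_mx))) ^+ k.+1) = \tr (lazy_mx ^+ k.+1) + 2^-1 ^+ k.+1.
Proof.
have -> : 2^-1 *: (1 + (walk_mx - stat_mx)) = 2^-1 *: (2 *: lazy_mx + stat_mx).
  rewrite /lazy_mx; move: walk_mx stat_mx => Q P.
  by apply/matrixP => i j; rewrite !mxE; field.
rewrite scalemx_expr exprD_ortho ?scalemx_expr ?mxtraceZ ?mxtraceD ?mxtraceZ ?(tr_stat_mx v).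
- by rewrite mulrDr mulrA -exprMn mulVf ?pnatr_eq0 // expr1n mul1r mulr1.
- by rewrite scale_mulmxl lazy_stat_mx scaler0.
- by rewrite scale_mulmxr stat_lazy_mx scaler0.
- exact: stat_mx_sq.
Qed.

(** The weights by degree make [walk_mx] self-adjoint. The energy [ndir] runs over ordered pairs,
    hence is twice the usual Dirichlet form. *)
Definition nip (f g : 'cV[R]_n) : R := \sum_v ndeg v * (f v 0 * g v 0).
Definition ndir (f : 'cV[R]_n) : R := \sum_v \sum_w (m v w)%:R * (f v 0 - f w 0) ^+ 2.
Definition nmean (f : 'cV[R]_n) : R := \sum_v ndeg v * f v 0.

Lemma nipC f g : nip f g = nip g f.
Proof. by apply: eq_bigr => v _; rewrite [_ * g _ _]mulrC. Qed.

Lemma nip_ge0 f : 0 <= nip f f.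
Proof. by apply: sumr_ge0 => v _; rewrite mulr_ge0 ?(ltW (dpos v)) // -expr2 sqr_ge0. Qed.

Lemma nip_eq0 f : nip f f = 0 -> f = 0.
Proof.
move=> /psumr_eq0P f0; apply/matrixP => v j; rewrite ord1 mxE.
have := f0 (fun v _ => mulr_ge0 (ltW (dpos v)) (sqr_ge0 (f v 0))) v isT.
by move/eqP; rewrite mulf_eq0 (negPf (dn0 v)) /= mulf_eq0 orbb => /eqP.
Qed.

Lemma ndir_ge0 f : 0 <= ndir f.
Proof.
by apply: sumr_ge0 => v _; apply: sumr_ge0 => w _; rewrite mulr_ge0 ?sqr_ge0.
Qed.

Lemma nip_walk (f g : 'cV[R]_n) : nip f (walk_mx *m g) = \sum_v \sum_w (m v w)%:R * (f v 0 * g w 0).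
Proof.
apply: eq_bigr => v _; rewrite mxE mulrA mulr_sumr; apply: eq_bigr => w _.
by rewrite mxE; field; exact: dn0.
Qed.

Lemma nip_walkC f g : nip f (walk_mx *m g) = nip (walk_mx *m f) g.
Proof.
rewrite [RHS]nipC !nip_walk exchange_big /=; apply: eq_bigr => v _.
by apply: eq_bigr => w _; rewrite msym [f _ _ * _]mulrC.
Qed.

Lemma nip_sumE (f : 'cV[R]_n) : nip f f = \sum_v \sum_w (m v w)%:R * f v 0 ^+ 2.
Proof. by apply: eq_bigr => v _; rewrite -mulr_suml -ndegE -expr2. Qed.

Lemma nip_sumE' (f : 'cV[R]_n) : nip f f = \sum_v \sum_w (m v w)%:R * f w 0 ^+ 2.
Proof.
rewrite nip_sumE exchange_big /=; apply: eq_bigr => v _; apply: eq_bigr => w _.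
by rewrite msym.
Qed.

Lemma ndirE f : ndir f = 2 * (nip f f - nip f (walk_mx *m f)).
Proof.
rewrite mulrBr mulr2n mulrDl !mul1r {1}nip_sumE {1}nip_sumE' nip_walk mulr_sumr -sumrN.
rewrite -!big_split /=; apply: eq_bigr => v _; rewrite mulr_sumr -sumrN -!big_split /=.
by apply: eq_bigr => w _; ring.
Qed.

Lemma ndir_sumE (f : 'cV[R]_n) : \sum_v \sum_w (m v w)%:R * (f v 0 + f w 0) ^+ 2
  = 2 * (nip f f + nip f (walk_mx *m f)).
Proof.
rewrite mulrDr mulr2n mulrDl !mul1r {1}nip_sumE {1}nip_sumE' nip_walk mulr_sumr.
rewrite -!big_split /=; apply: eq_bigr => v _; rewrite mulr_sumr -!big_split /=.
by apply: eq_bigr => w _; ring.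
Qed.

Lemma nip_statE f g : nip f (stat_mx *m g) = nmean f * (nmean g / nvol).
Proof.
rewrite /nmean [RHS]mulr_suml; apply: eq_bigr => v _; rewrite mxE mulrA.
congr (_ * _); rewrite mulr_suml; apply: eq_bigr => w _.
by rewrite mxE mulrAC.
Qed.

Lemma ndir_eq0_const (f : 'cV[R]_n) v w : ndir f = 0 -> f v 0 = f w 0.
Proof.
move=> f0; have edge a b : (0 < m a b)%N -> f a 0 = f b 0.
  move=> mab.
  have h0 : \sum_w (m a w)%:R * (f a 0 - f w 0) ^+ 2 = 0.
    have /psumr_eq0P := f0; apply => // i _.
    by apply: sumr_ge0 => j _; rewrite mulr_ge0 ?sqr_ge0.
  have h1 : (m a b)%:R * (f a 0 - f b 0) ^+ 2 = 0.
    have /psumr_eq0P := h0; apply => // i _.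
    by rewrite mulr_ge0 ?sqr_ge0.
  move/eqP: h1; rewrite mulf_eq0 pnatr_eq0 eqn0Ngt mab /= sqrf_eq0 subr_eq0.
  by move/eqP.
have /connectP[p vp ->] := mconn v w.
elim: p v vp => //= u p IH v /andP[vu up].
by rewrite (edge _ _ vu) IH.
Qed.

End Network.

Lemma cauchy_schwarz_sum (R : realFieldType) (I : finType) (c a b : I -> R) :
  (forall i, 0 <= c i) ->
  (\sum_i c i * (a i * b i)) ^+ 2 <= (\sum_i c i * a i ^+ 2) * (\sum_i c i * b i ^+ 2).
Proof.
move=> c0; set B := \sum_i c i * (_ * _); set A := \sum_i c i * a i ^+ 2.
set D := \sum_i _.
have D0 : 0 <= D by apply: sumr_ge0 => i _; rewrite mulr_ge0 ?sqr_ge0.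
have : 0 <= \sum_i c i * (D * a i - B * b i) ^+ 2.
  by apply: sumr_ge0 => i _; rewrite mulr_ge0 ?sqr_ge0.
have -> : \sum_i c i * (D * a i - B * b i) ^+ 2 = D * (A * D - B ^+ 2).
  transitivity (\sum_i D ^+ 2 * (c i * a i ^+ 2) - \sum_i (2 * D * B) * (c i * (a i * b i))
    + \sum_i B ^+ 2 * (c i * b i ^+ 2)).
    by rewrite -sumrN -!big_split; apply: eq_bigr => i _ /=; ring.
  by rewrite -!mulr_sumr -/A -/B -/D; ring.
case: (ltgtP 0 D) D0 => // [D0 _|D0 _ _]; first by rewrite pmulr_rge0 // subr_ge0.
have b0 i : c i * b i ^+ 2 = 0.
  have /psumr_eq0P := esym D0; apply => // j _.
  by rewrite mulr_ge0 ?sqr_ge0.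
rewrite -D0 mulr0 /B big1 ?expr0n // => i _; apply/eqP.
have /eqP := b0 i; rewrite mulf_eq0 sqrf_eq0 !mulf_eq0 => /orP[->//|->].
by rewrite !orbT.
Qed.

(** The path is first made simple, so that each [psi v] is paid at most once. *)
Lemma path_increment (R : numDomainType) (V : finType) (e : rel V) (H psi : V -> R) :
  (forall v, 0 <= psi v) -> (forall a b, e a b -> H a - H b <= psi a) ->
  forall x y, connect e x y -> H x - H y <= \sum_v psi v.
Proof.
move=> psi0 He x y /connectP[p0 ep0 ->].
case/shortenP: ep0 => p ep up _ {p0}.
have step : H x - H (last x p) <= \sum_(v <- x :: p) psi v.
  elim: p x ep {up} => [|u p IH] x /=; first by rewrite subrr big_seq1.
  move=> /andP[xu up]; rewrite big_cons -(subrKA (H u)).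
  by apply: lerD; [exact: He | exact: IH].
apply: le_trans step _; rewrite big_uniq //=.
rewrite [leRHS](bigID (mem (x :: p))) /= lerDl.
by apply: sumr_ge0 => v _; exact: psi0.
Qed.

Lemma sqr_pos_part_sub (R : realFieldType) (p q : R) :
  Num.max p 0 ^+ 2 - Num.max q 0 ^+ 2 <= `|p - q| * (`|p| + `|q|).
Proof.
have key : `|p ^+ 2 - q ^+ 2| <= `|p - q| * (`|p| + `|q|).
  by rewrite subr_sqr normrM ler_wpM2l // ler_normD.
have h0 : 0 <= `|p - q| * (`|p| + `|q|) by rewrite mulr_ge0 ?addr_ge0.
case: (leP p 0) => p0.
  by apply: le_trans h0; rewrite expr0n sub0r oppr_le0 sqr_ge0.
case: (leP q 0) => q0; last exact: le_trans (ler_norm _) key.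
rewrite expr0n subr0 expr2; apply: ler_pM; [exact: ltW | exact: ltW | |].
  by rewrite ger0_norm; lra.
by rewrite (gtr0_norm p0) lerDl.
Qed.

Section NetworkSpectrum.
Variables (R : realType) (n : nat) (m : 'I_n -> 'I_n -> nat).
Local Notation V := 'I_n.
Local Notation d := (@ndeg R n m).
Local Notation vol := (@nvol R n m).
Local Notation Q := (@walk_mx R n m).
Local Notation P := (@stat_mx R n m).
Local Notation C := (@lazy_mx R n m).
Local Notation ip := (@nip R n m).
Local Notation dir := (@ndir R n m).
Local Notation mean := (@nmean R n m).
Hypothesis msym : forall v w, m v w = m w v.
Hypothesis mconn : forall v w, connect (fun a b => (0 < m a b)%N) v w.
Hypothesis dpos : forall v, 0 < d v.
Implicit Types f g : 'cV[R]_n.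

Let dn0 v : d v != 0. Proof. exact: lt0r_neq0. Qed.
Let voln0 (v : V) : vol != 0. Proof. exact: lt0r_neq0 (nvol_gt0 dpos v). Qed.

Lemma nipDr f g h : ip f (g + h) = ip f g + ip f h.
Proof. by rewrite -big_split; apply: eq_bigr => v _; rewrite mxE !mulrDr. Qed.

Lemma nipZr a f g : ip f (a *: g) = a * ip f g.
Proof. by rewrite mulr_sumr; apply: eq_bigr => v _; rewrite mxE; ring. Qed.

Lemma nipNr f g : ip f (- g) = - ip f g.
Proof. by rewrite -scaleN1r nipZr mulN1r. Qed.

Lemma nmeanE f : mean f = ip (const_mx 1) f.
Proof. by apply: eq_bigr => v _; rewrite mxE mul1r. Qed.

Lemma nmean_walk f : mean (Q *m f) = mean f.
Proof.
rewrite !nmeanE (nip_walkC msym dpos); congr (ip _ _).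
apply/colP => v; rewrite !mxE; under eq_bigr do rewrite [const_mx _ _ _]mxE mulr1.
exact: walk_mx_sum.
Qed.

Lemma nmean_stat f : mean (P *m f) = mean f.
Proof.
rewrite nmeanE nip_statE.
have -> : mean (const_mx 1) = vol by apply: eq_bigr => v _; rewrite mxE mulr1.
case: (posnP n) => n0.
  by rewrite /nmean !big1 ?mul0r ?mulr0 // => v _; exfalso; have := ltn_ord v; lia.
by rewrite mulrC divfK // (voln0 (Ordinal n0)).
Qed.

Lemma nmean_eigen f a : (Q - P) *m f = a *: f -> a * mean f = 0.
Proof.
move=> Bf; rewrite [mean f]nmeanE -nipZr -nmeanE -Bf mulmxBl nmeanE nipDr nipNr -!nmeanE.
by rewrite nmean_walk nmean_stat subrr.
Qed.

(** The sums of [(f v + f w)^2] and [(f v - f w)^2] over edges are nonnegative. If [a >= 1], the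
    energy vanishes, so [f] is constant by connectedness, and its mean is 0, so [f = 0]. The value
    -1 does occur, for bipartite graphs. *)
Lemma eigenvalue_bounds f a : f != 0 -> (Q - P) *m f = a *: f -> -1 <= a < 1.
Proof.
move=> fn0 Bf.
have ff : 0 < ip f f.
  rewrite lt_neqAle nip_ge0 // andbT eq_sym; apply: contra fn0 => /eqP f0.
  by apply/eqP; exact: nip_eq0 f0.
have [v _] : exists v, f v 0 != 0.
  apply/existsP; apply: contraNT fn0; rewrite negb_exists => /forallP f0.
  apply/eqP/colP => v; rewrite mxE; apply/eqP; by rewrite -[_ == _]negbK f0.
have v0 := nvol_gt0 dpos v.
have fQf : a * ip f f = ip f (Q *m f) - mean f * (mean f / vol).
  by rewrite -nipZr -Bf mulmxBl nipDr nipNr nip_statE.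
have := nmean_eigen Bf; have := ndir_ge0 m f; rewrite (ndirE msym dpos) => dir0 amean.
apply/andP; split.
  have [->|an0] := eqVneq a 0; first by rewrite lerN10.
  move/eqP: amean; rewrite mulf_eq0 (negPf an0) /= => /eqP mean0.
  rewrite mean0 mul0r subr0 in fQf.
  have : 0 <= \sum_v \sum_w (m v w)%:R * (f v 0 + f w 0) ^+ 2.
    by apply: sumr_ge0 => i _; apply: sumr_ge0 => j _; rewrite mulr_ge0 ?sqr_ge0.
  rewrite (ndir_sumE msym dpos) -fQf -{1}[ip f f]mul1r -mulrDl pmulr_rge0 //.
  by rewrite pmulr_lge0 //; lra.
have mm : 0 <= mean f * (mean f / vol) by rewrite mulrA -expr2 divr_ge0 ?sqr_ge0 // ltW.
rewrite ltNge; apply/negP => a1.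
have a1' : ip f f <= a * ip f f by rewrite ler_peMl // ltW.
have mm0 : mean f * (mean f / vol) = 0 by apply/eqP; rewrite eq_le mm andbT; lra.
have mean0 : mean f = 0.
  move/eqP: mm0; rewrite mulrA mulf_eq0 invr_eq0 (negPf (lt0r_neq0 v0)) orbF.
  by rewrite mulf_eq0 orbb => /eqP.
have d0 : dir f = 0 by rewrite (ndirE msym dpos); lra.
have fc w : f w 0 = f v 0 by exact: ndir_eq0_const d0.
have : mean f = vol * f v 0 by rewrite mulr_suml; apply: eq_bigr => w _; rewrite fc.
rewrite mean0 => /esym/eqP; rewrite mulf_eq0 (negPf (lt0r_neq0 v0)) /= => /eqP fv.
by move: fn0; rewrite -subr_eq0 subr0 => /eqP[]; apply/colP => w; rewrite mxE fc.
Qed.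

Lemma walk_spectrum : exists l : 'I_n -> R,
  [/\ forall i, -1 <= l i < 1,
      \det (1%:M - (Q - P)) = \prod_i (1 - l i),
      forall k, \tr ((Q - P) ^+ k) = \sum_i l i ^+ k &
      forall k, \tr ((2^-1 *: (1 + (Q - P))) ^+ k) = \sum_i ((1 + l i) / 2) ^+ k].
Proof.
pose a v := Num.sqrt (d v).
have a2 v : a v ^+ 2 = d v by rewrite sqr_sqrtr // ltW.
have an0 v : a v != 0 by rewrite sqrtr_eq0 -ltNge.
pose N : 'M[R]_n := \matrix_(v, w) (a v * (Q - P) v w / a w).
have NT : N^T = N.
  apply/matrixP => v w; rewrite !mxE msym -!a2.
  have := voln0 v; set W := vol => W0.
  by field; rewrite W0 !an0.
have [S0 [l [S0u NS]]] := symmetric_diagonalizable NT.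
pose A : 'M[R]_n := diag_mx (\row_v (a v)^-1).
have Au : A \in unitmx.
  rewrite unitmxE det_diag unitfE; apply/prodf_neq0 => v _.
  by rewrite mxE invr_eq0.
have BA : (Q - P) *m A = A *m N.
  apply/matrixP => v w; rewrite mul_mx_diag mul_diag_mx !mxE.
  by rewrite -!mulrA mulKf.
pose S := A *m S0.
have Su : S \in unitmx by rewrite unitmx_mul Au.
have BS : (Q - P) *m S = S *m diag_mx l by rewrite mulmxA BA -mulmxA NS mulmxA.
exists (fun i => l 0 i); split.
- move=> i; apply: (@eigenvalue_bounds (col i S)).
    apply/negP => /eqP Si; have : (invmx S *m col i S) i 0 = 0 by rewrite Si mulmx0 mxE.
    by rewrite colE mulmxA mulVmx // mul1mx !mxE !eqxx => /eqP; rewrite oner_eq0.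
  rewrite colE mulmxA BS -mulmxA scalemxAr; congr (_ *m _).
  apply/matrixP => v w; rewrite mul_diag_mx !mxE.
  by case: eqP => [->|_] //; rewrite !mulr0.
- rewrite (@diagonalizable_det _ _ _ S (\row_j (1 - l 0 j))) //.
    by apply: eq_bigr => i _; rewrite mxE.
  rewrite mulmxBl mul1mx BS -{1}[S]mulmx1 -mulmxBr; congr (_ *m _).
  by apply/matrixP => i j; rewrite !mxE; case: eqP => _; rewrite ?subr0 // mulr1n.
- move=> k; rewrite (diagonalizable_tr Su (diagonalizable_expr BS k)).
  by apply: eq_bigr => i _; rewrite mxE.
- move=> k.
  have HS : 2^-1 *: (1 + (Q - P)) *m S = S *m diag_mx (\row_j ((1 + l 0 j) / 2)).
    rewrite -scalemxAl mulmxDl mul1mx BS -{1}[S]mulmx1 -mulmxDr scalemxAr.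
    congr (_ *m _); apply/matrixP => i j; rewrite !mxE.
    by case: eqP => _; rewrite ?addr0 ?mulr0 // !mulr1n mulrC.
  rewrite (diagonalizable_tr Su (diagonalizable_expr HS k)).
  by apply: eq_bigr => i _; rewrite !mxE.
Qed.

End NetworkSpectrum.

(** * The heat kernel of the lazy walk *)

Section HeatKernel.
Variables (R : realType) (n : nat) (m : 'I_n -> 'I_n -> nat).
Local Notation V := 'I_n.
Local Notation d := (@ndeg R n m).
Local Notation vol := (@nvol R n m).
Local Notation Q := (@walk_mx R n m).
Local Notation P := (@stat_mx R n m).
Local Notation C := (@lazy_mx R n m).
Local Notation ip := (@nip R n m).
Local Notation dir := (@ndir R n m).
Local Notation mean := (@nmean R n m).
Hypothesis msym : forall v w, m v w = m w v.
Hypothesis mconn : forall v w, connect (fun a b => (0 < m a b)%N) v w.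
Hypothesis dpos : forall v, 0 < d v.
Implicit Types f g : 'cV[R]_n.

Lemma lazy_mulE f : C *m f = 2^-1 *: (f + Q *m f) - P *m f.
Proof. by rewrite mulmxBl -scalemxAl mulmxDl mul1mx. Qed.

Lemma nip_lazy f g :
  ip f (C *m g) = 2^-1 * (ip f g + ip f (Q *m g)) - mean f * (mean g / vol).
Proof. by rewrite lazy_mulE nipDr nipNr nip_statE nipZr nipDr. Qed.

Lemma nip_lazyC f g : ip f (C *m g) = ip (C *m f) g.
Proof.
rewrite [RHS]nipC !nip_lazy (nip_walkC msym dpos) [ip f g]nipC.
by rewrite [ip (_ *m f) g]nipC; ring.
Qed.

Lemma nip_lazy_expr k f g : ip (C ^+ k *m f) g = ip f (C ^+ k *m g).
Proof.
elim: k f g => [|k IH] f g; first by rewrite !expr0 !mul1mx.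
by rewrite [in LHS]exprS [in RHS]exprSr -!mulmxE -!mulmxA -nip_lazyC IH.
Qed.

Lemma nmean_lazy f : mean (C *m f) = 0.
Proof.
rewrite nmeanE lazy_mulE nipDr nipNr nipZr nipDr -!nmeanE.
by rewrite nmean_walk // nmean_stat //; field.
Qed.

(** With [g = Q *m f], the nonnegative sum of [(g v - f w)^2] over edges equals
    [ip f f - ip g g]. *)
Lemma nip_walk_contract f : ip (Q *m f) (Q *m f) <= ip f f.
Proof.
set g := Q *m f.
have : 0 <= \sum_v \sum_w (m v w)%:R * (g v 0 - f w 0) ^+ 2.
  by apply: sumr_ge0 => i _; apply: sumr_ge0 => j _; rewrite mulr_ge0 ?sqr_ge0.
have -> : \sum_v \sum_w (m v w)%:R * (g v 0 - f w 0) ^+ 2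
    = ip g g + ip f f - 2 * ip g (Q *m f).
  rewrite {1}nip_sumE (nip_sumE' msym f) (nip_walk dpos) mulr_sumr -sumrN.
  rewrite -!big_split /=; apply: eq_bigr => v _; rewrite mulr_sumr -sumrN -!big_split /=.
  by apply: eq_bigr => w _; ring.
by rewrite -/g; lra.
Qed.

(** Expanding the square of [(f + Q f) / 2] and bounding [ip (Q f) (Q f)] by [ip f f] leaves half of
    [ip f f - ip f (Q f)], which is a quarter of the energy. *)
Lemma nip_lazy_decr f : mean f = 0 -> dir f / 4 <= ip f f - ip (C *m f) (C *m f).
Proof.
move=> f0; have Pf : P *m f = 0.
  apply/colP => v; rewrite !mxE.
  under eq_bigr do rewrite mxE mulrAC.
  by rewrite -mulr_suml -/(nmean m f) f0 mul0r.
rewrite lazy_mulE Pf subr0 (ndirE msym dpos); set g := Q *m f.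
have -> : ip (2^-1 *: (f + g)) (2^-1 *: (f + g)) = 4^-1 * (ip f f + 2 * ip f g + ip g g).
  by rewrite nipZr nipC nipZr nipDr ![ip (f + g) _]nipC !nipDr [ip g f]nipC; field.
by have := nip_walk_contract f; lra.
Qed.

(** Mean zero gives a vertex [y] with [f y <= 0]. Along a simple path from [x] to [y] the squared
    positive part falls from [f x ^ 2] to 0, each step costing at most the sum [psi] over the edges
    at its starting vertex; Cauchy-Schwarz over all edges bounds the total cost. No bound on the
    degrees enters. *)
Lemma nip_pointwise f x : mean f = 0 -> 0 <= f x 0 -> f x 0 ^+ 4 <= 4 * dir f * ip f f.
Proof.
move=> f0 fx0; have [y fy] : exists y, f y 0 <= 0.
  apply: contrapT => /forallNP npos; have fpos v : 0 < f v 0 by rewrite ltNge; apply/negP.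
  have : 0 < mean f.
    rewrite /nmean (bigD1 x) //= ltr_pwDl ?mulr_gt0 //.
    by apply: sumr_ge0 => v _; rewrite mulr_ge0 ?ltW.
  by rewrite f0 ltxx.
pose psi v := \sum_w (m v w)%:R * (`|f v 0 - f w 0| * (`|f v 0| + `|f w 0|)).
have t0 v w : 0 <= (m v w)%:R * (`|f v 0 - f w 0| * (`|f v 0| + `|f w 0|)).
  by rewrite !mulr_ge0 ?addr_ge0.
have psi0 v : 0 <= psi v by apply: sumr_ge0.
have := path_increment (H := fun v => Num.max (f v 0) 0 ^+ 2) psi0 _ (mconn x y).
rewrite (max_l fx0) (max_r fy) expr0n subr0 => le2.
have {}le2 : f x 0 ^+ 2 <= \sum_v psi v.
  apply: le2 => a b mab; apply: le_trans (sqr_pos_part_sub _ _) _.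
  rewrite /psi (bigD1 b) //= -[leLHS]addr0 lerD ?sumr_ge0 //.
  by rewrite ler_peMl ?mulr_ge0 ?addr_ge0 // ler1n.
have -> : f x 0 ^+ 4 = (f x 0 ^+ 2) ^+ 2 by rewrite -exprM.
apply: le_trans (_ : (\sum_v psi v) ^+ 2 <= _).
  by rewrite ler_sqr ?nnegrE ?sqr_ge0 ?sumr_ge0.
rewrite /psi pair_big /=.
apply: le_trans (cauchy_schwarz_sum _ _ _) _ => //=.
have -> : \sum_i (m i.1 i.2)%:R * `|f i.1 0 - f i.2 0| ^+ 2 = dir f.
  rewrite /ndir pair_big /=; apply: eq_bigr => i _.
  by rewrite real_normK ?num_real.
rewrite [4 * _]mulrC -mulrA ler_wpM2l ?ndir_ge0 //.
have -> : 4 * ip f f = \sum_v \sum_w (m v w)%:R * (2 * (f v 0 ^+ 2 + f w 0 ^+ 2)).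
  transitivity (2 * (ip f f + ip f f)); first by ring.
  rewrite {1}nip_sumE (nip_sumE' msym f) -big_split mulr_sumr /=.
  apply: eq_bigr => v _; rewrite -big_split mulr_sumr /=.
  by apply: eq_bigr => w _; ring.
rewrite pair_big /=; apply: ler_sum => i _; rewrite ler_wpM2l //.
rewrite -(real_normK (num_real (f i.1 0))) -(real_normK (num_real (f i.2 0))).
by have := sqr_ge0 (`|f i.1 0| - `|f i.2 0|); lra.
Qed.

Section Point.
Variable x : V.
(** [g0] represents evaluation at [x] for [ip], so by self-adjointness [u j] is the kernel at time
    [2 j] on the diagonal, divided by the degree. Its mean is 1, so estimates for mean zero start at
    index 1. *)
Let g0 : 'cV[R]_n := (d x)^-1 *: delta_mx x 0.
Let h j : 'cV[R]_n := C ^+ j *m g0.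
Let u j := ip (h j) (h j).

Let hS j : h j.+1 = C *m h j. Proof. by rewrite /h exprS -mulmxE mulmxA. Qed.

Let ipg f : ip g0 f = f x 0.
Proof.
rewrite /nip (bigD1 x) //= big1 ?addr0; last first.
  by move=> v vx; rewrite !mxE (negPf vx) /= mulr0 mul0r mulr0.
by rewrite !mxE !eqxx mulr1 mulrA mulfV ?mul1r // lt0r_neq0.
Qed.

Let uE j : u j = h (j + j)%N x 0.
Proof. by rewrite /u /h nip_lazy_expr ipg mulmxA exprD. Qed.

Let u0 j : 0 <= u j. Proof. exact: nip_ge0. Qed.

Let hmean j : mean (h j.+1) = 0. Proof. by rewrite hS nmean_lazy. Qed.

Let udecr j : dir (h j.+1) / 4 <= u j.+1 - u j.+2.
Proof. by rewrite /u (hS j.+1); apply: nip_lazy_decr. Qed.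

Let umono j : u j.+2 <= u j.+1.
Proof. by have := udecr j; have := ndir_ge0 m (h j.+1); lra. Qed.

Let umono' i j : (i <= j)%N -> u j.+1 <= u i.+1.
Proof.
elim: j => [|j IH]; first by rewrite leqn0 => /eqP->.
rewrite leq_eqVlt => /orP[/eqP->//|]; rewrite ltnS => /IH.
exact: le_trans (umono j).
Qed.

(** Apply [nip_pointwise] to [h] at time [2 (j + 1)], whose value at [x] is [u j.+1]: its energy is
    at most 4 times the decrease of [u], its norm is at most [u j.+1], and one factor [u j.+1]
    cancels. *)
Let ucube j : u j.+1 ^+ 3 <= 16 * (u (j.+1 + j.+1)%N - u (j.+2 + j.+2)%N).
Proof.
have [->|un0] := eqVneq (u j.+1) 0.
  by rewrite expr0n /= mulr_ge0 // subr_ge0 !addSn; apply: umono'; lia.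
have up : 0 < u j.+1 by rewrite lt_neqAle eq_sym un0 u0.
have := @nip_pointwise (h (j.+1 + j.+1)%N) x.
rewrite -uE addSn => /(_ (hmean _) (u0 _)) k1.
have k2 := udecr (j + j.+1)%N.
have k3 : u (j + j.+1).+2 >= u (j.+2 + j.+2)%N by rewrite !addSn; apply: umono'; lia.
have k4 : u (j + j.+1).+1 <= u j.+1 by apply: umono'; lia.
have D0 := ndir_ge0 m (h (j + j.+1).+1).
rewrite -(ler_pM2r up) -exprSr; apply: le_trans k1 _.
rewrite -/(u _); apply: ler_pM => //; [by rewrite mulr_ge0 | lra].
Qed.

Let usum J : \sum_(J <= i < J + J.+1) u i.+1 ^+ 3 <= 16 * u (J.+1 + J.+1)%N.
Proof.
have tel k : \sum_(J <= i < J + k) u i.+1 ^+ 3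
    <= 16 * (u (J.+1 + J.+1)%N - u ((J + k).+1 + (J + k).+1)%N).
  elim: k => [|k IH]; first by rewrite addn0 big_geq // subrr mulr0.
  rewrite addnS big_nat_recr ?leq_addr //=.
  by have := ucube (J + k)%N; lra.
by apply: le_trans (tel J.+1) _; have := u0 ((J + J.+1).+1 + (J + J.+1).+1)%N; lra.
Qed.

(** Put [U = u (2 J + 2)]. The telescoped cubes over the [J + 1] preceding indices are each at least
    [U ^ 3], whence [(J + 1) U ^ 3 <= 16 U]. *)
Lemma lazy_mx_diag (J : nat) :
  (C ^+ (4 * J.+1)) x x / d x <= 4 / Num.sqrt (J.+1)%:R.
Proof.
have -> : (C ^+ (4 * J.+1)) x x / d x = u (J.+1 + J.+1)%N.
  rewrite uE (_ : (_ + _)%N = (4 * J.+1)%N); last lia.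
  rewrite /h -scalemxAr mxE mulrC; congr (_ * _).
  rewrite mxE (bigD1 x) //= mxE !eqxx mulr1 big1 ?addr0 // => v vx.
  by rewrite mxE (negPf vx) mulr0.
set U := u _; have U0 : 0 <= U by exact: u0.
have J0 : 0 < J.+1%:R :> R by rewrite ltr0n.
have cube : J.+1%:R * U ^+ 3 <= 16 * U.
  apply: le_trans (usum J).
  have -> : J.+1%:R * U ^+ 3 = \sum_(J <= i < J + J.+1) U ^+ 3.
    by rewrite big_const_nat addKn iter_addr addr0 mulr_natl.
  apply: ler_sum_nat => i /andP[_ iJ]; rewrite lerXn2r ?nnegrE //.
  by rewrite /U addSn; apply: umono'; lia.
have [->|Un0] := eqVneq U 0; first by rewrite divr_ge0 ?sqrtr_ge0.
have Up : 0 < U by rewrite lt_neqAle eq_sym Un0.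
have sq : J.+1%:R * U ^+ 2 <= 16.
  by rewrite -(ler_pM2r Up) -mulrA -exprSr.
rewrite ler_pdivlMr ?sqrtr_gt0 // -(@ler_pXn2r _ 2) ?nnegrE ?mulr_ge0 ?sqrtr_ge0 //.
by rewrite exprMn sqr_sqrtr ?ler0n // mulrC; apply: le_trans sq _; rewrite -natrX ler_nat.
Qed.
End Point.
End HeatKernel.

(** * The logarithm of the number of spanning trees of a finite graph *)

Section LogTail.
Variable R : realType.
Implicit Types (x s a b : R) (K M : nat).

(** The remainder of the logarithm series after [K] terms. All bounds on it come from its derivative
    [x ^ K / (1 - x)]. *)
Definition log_tail K x : R := - ln (1 - x) - \sum_(1 <= k < K.+1) x ^+ k / k%:R.

Lemma log_tailS K x : log_tail K.+1 x = log_tail K x - x ^+ K.+1 / K.+1%:R.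
Proof. by rewrite /log_tail big_nat_recr //= opprD addrA. Qed.

Lemma log_tail0 K : log_tail K 0 = 0.
Proof.
rewrite /log_tail subr0 ln1 oppr0 sub0r big_nat_cond big1 ?oppr0 // => k.
by case: k => // k _; rewrite expr0n /= mul0r.
Qed.

Lemma is_derive_log_tail K x : x < 1 -> is_derive x 1 (log_tail K) (x ^+ K / (1 - x)).
Proof.
move=> x1; elim: K => [|K IH].
  have -> : log_tail 0 = (fun s => - ln (1 - s)).
    by apply/funext => s; rewrite /log_tail big_geq // subr0.
  have d1 : is_derive (1 - x) (1 : R) (@ln R) (1 - x)^-1 by apply: is_derive1_ln; lra.
  have d2 : is_derive x (1 : R) (fun s => 1 - s) (-1).
    by apply: is_derive_eq; rewrite add0r mul1r.
  have := is_deriveN (@is_derive1_comp _ (@ln R) (fun s => 1 - s) x _ _ d1 d2).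
  by rewrite expr0 div1r mulrN1 opprK.
have dX : is_derive x 1 (fun s : R => s ^+ K.+1 / K.+1%:R) (x ^+ K).
  have -> : (fun s : R => s ^+ K.+1 / K.+1%:R) = K.+1%:R^-1 \*: (id ^+ K.+1 : R -> R).
    by apply/funext => s; rewrite /= exprfctE mulrC.
  apply: is_derive_eq; rewrite /= scaler1 /GRing.scale /= mulrA mulVf ?mul1r //.
have -> : log_tail K.+1 = log_tail K - (fun s => s ^+ K.+1 / K.+1%:R).
  by apply/funext => s; rewrite log_tailS.
have -> : x ^+ K.+1 / (1 - x) = x ^+ K / (1 - x) - x ^+ K.
  by rewrite exprS; field; rewrite subr_eq0 gt_eqF.
exact: is_deriveB.
Qed.

Lemma ler_derive (f df : R -> R) a b : a <= b ->
  (forall x, a <= x <= b -> is_derive x 1 f (df x)) ->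
  (forall x, a <= x <= b -> 0 <= df x) -> f a <= f b.
Proof.
move=> ab fd df0.
have [||c] := @MVT_segment R f df a b ab.
- by move=> x; rewrite in_itv /= => /andP[ax xb]; apply: fd; rewrite !ltW.
- apply: derivable_within_continuous => x; rewrite in_itv /= => xab.
  by have [] := fd x xab.
- rewrite in_itv /= => cab e; rewrite -subr_ge0 e mulr_ge0 ?subr_ge0 //.
  exact: df0.
Qed.

Lemma log_tail_ge0 K x : 0 <= x < 1 -> 0 <= log_tail K x.
Proof.
move=> /andP[x0 x1]; rewrite -[leLHS](log_tail0 K).
apply: (ler_derive x0 (df := fun s => s ^+ K / (1 - s))) => s /andP[s0 sx].
  by apply: is_derive_log_tail; lra.
by rewrite divr_ge0 ?exprn_ge0 //; lra.
Qed.

(** Not uniform as [x] approaches 1; it serves to make the remainder vanish along a fixed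
    spectrum. *)
Lemma log_tail_le K x : 0 <= x < 1 -> log_tail K x <= x ^+ K * (x / (1 - x)).
Proof.
move=> /andP[x0 x1]; have [||c] := @MVT_segment R (log_tail K) (fun s => s ^+ K / (1 - s)) 0 x x0.
- by move=> s; rewrite in_itv /= => /andP[s0 sx]; apply: is_derive_log_tail; lra.
- apply: derivable_within_continuous => s; rewrite in_itv /= => /andP[s0 sx].
  have s1 : s < 1 by lra.
  by have [] := is_derive_log_tail K s1.
rewrite in_itv /= => /andP[c0 cx]; rewrite log_tail0 !subr0 => ->.
rewrite -mulrA ler_pM ?exprn_ge0 ?mulr_ge0 ?invr_ge0 ?lerXn2r ?nnegrE //; first lra.
by rewrite mulrC ler_wpM2l // lef_pV2 ?posrE; lra.
Qed.

(* Comparison with [(- s) ^+ K], whose primitive is explicit. *)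
Lemma log_tail_neg K x : -1 <= x <= 0 -> `|log_tail K x| <= K.+1%:R^-1.
Proof.
move=> /andP[x1 x0].
pose H s : R := - ((- s) ^+ K.+1 / K.+1%:R).
have dH s : is_derive s 1 H ((- s) ^+ K).
  have -> : H = - (K.+1%:R^-1 \*: ((fun s : R => - s) ^+ K.+1 : R -> R)).
    by apply/funext => t; rewrite /H !fctE mulrC.
  apply: is_derive_eq; rewrite /= /GRing.scale /= mulrN1 mulrN opprK mulrA.
  by rewrite mulVf ?mul1r.
have key s : x <= s <= 0 -> - (- s) ^+ K <= s ^+ K / (1 - s) <= (- s) ^+ K.
  move=> /andP[xs s0]; rewrite -ler_norml normrM normrX normfV.
  rewrite (ler0_norm s0) (gtr0_norm (_ : 0 < 1 - s)); last by lra.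
  by rewrite ler_piMr ?exprn_ge0 ?invf_le1; lra.
have Hx : - K.+1%:R^-1 <= H x.
  rewrite /H lerN2 ler_piMl ?invr_ge0 // exprn_ile1; lra.
have H0 : H 0 = 0 by rewrite /H oppr0 expr0n /= mul0r oppr0.
rewrite ler_norml; apply/andP; split.
  have : log_tail K 0 - H 0 <= log_tail K x - H x.
    rewrite -lerN2; apply: (ler_derive x0 (f := - (log_tail K - H))
      (df := fun s => - (s ^+ K / (1 - s) - (- s) ^+ K))) => s /andP[xs s0].
      by apply: is_deriveN; apply: is_deriveB; apply: is_derive_log_tail; lra.
    have /key/andP[] : x <= s <= 0 by rewrite xs.
    by lra.
  by rewrite log_tail0 H0 subr0 subr_ge0; exact: le_trans.
have : log_tail K x + H x <= log_tail K 0 + H 0.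
  apply: (ler_derive x0 (f := log_tail K + H)
    (df := fun s => s ^+ K / (1 - s) + (- s) ^+ K)) => s /andP[xs s0].
    by apply: is_deriveD; apply: is_derive_log_tail; lra.
  have /key/andP[] : x <= s <= 0 by rewrite xs.
  by lra.
by rewrite log_tail0 H0 addr0 -lerBrDr sub0r => h; apply: le_trans h _; rewrite lerNl.
Qed.

Lemma sum_inv_k_sqrt (K M : nat) : (0 < K)%N -> (K <= M)%N ->
  \sum_(K.+1 <= k < M.+1) (k%:R * Num.sqrt k%:R)^-1 <= 2 / Num.sqrt K%:R :> R.
Proof.
(* The sharper telescoping bound is what the induction on [M] proves. *)
move=> K0 KM; apply: (@le_trans _ _ (2 / Num.sqrt K%:R - 2 / Num.sqrt M%:R)); last first.
  by rewrite gerBl divr_ge0 ?sqrtr_ge0.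
elim: M KM => [|M IH]; first by rewrite leqn0 => /eqP K0'; rewrite K0' in K0.
rewrite leq_eqVlt => /orP[/eqP->|]; first by rewrite big_geq // subrr.
rewrite ltnS => KM; rewrite big_nat_recr //=.
apply: le_trans (lerD (IH KM) (lexx _)) _.
have M0 : 0 < M%:R :> R by rewrite ltr0n; lia.
have S1 : M.+1%:R = M%:R + 1 :> R by rewrite -natr1.
set a := Num.sqrt M%:R; set b := Num.sqrt M.+1%:R.
have a0 : 0 < a by rewrite sqrtr_gt0.
have b0 : 0 < b by rewrite sqrtr_gt0 ltr0n.
have a2 : a ^+ 2 = M%:R by rewrite sqr_sqrtr // ltW.
have b2 : b ^+ 2 = M.+1%:R by rewrite sqr_sqrtr.
have ab : a < b by rewrite ltr_sqrt ?ltr0n // S1 ltrDl.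
rewrite -b2.
suff : (b ^+ 2 * b)^-1 <= 2 / a - 2 / b by lra.
have -> : 2 / a - 2 / b = 2 * (b - a) / (a * b) by field; rewrite !gt_eqF.
rewrite ler_pdivlMr ?mulr_gt0 // mulrC ler_pdivrMr ?mulr_gt0 ?exprn_gt0 //.
have -> : a * b = a * b * ((b - a) * (b + a)).
  by rewrite -subr_sqr b2 a2 S1; ring.
rewrite -subr_ge0.
have -> : 2 * (b - a) * (b ^+ 2 * b) - a * b * ((b - a) * (b + a))
  = (b - a) * b * ((b - a) * (2 * b + a)) by ring.
by rewrite !mulr_ge0 ?subr_ge0 ?addr_ge0 ?mulr_ge0 ?(ltW ab) ?(ltW a0) ?(ltW b0).
Qed.
End LogTail.

Lemma cvg_sumr (R : realType) (T I : Type) (F : set_system T) (FF : Filter F) (r : seq I)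
    (P : pred I) (f : I -> T -> R) (a : I -> R) :
  (forall i, P i -> f i x @[x --> F] --> a i) ->
  \sum_(i <- r | P i) f i x @[x --> F] --> \sum_(i <- r | P i) a i.
Proof.
move=> fa; elim: r => [|i r IH].
  by rewrite big_nil; under eq_fun do rewrite big_nil; exact: cvg_cst.
rewrite big_cons; under eq_fun do rewrite big_cons.
by case: ifPn => // Pi; apply: cvgD; [exact: fa | exact: IH].
Qed.

(** * Uniform bound for the tail of the logarithm series over the spectrum *)

Section SpectralTail.
Variables (R : realType) (n : nat) (m : 'I_n -> 'I_n -> nat).
Local Notation d := (@ndeg R n m).
Local Notation vol := (@nvol R n m).
Local Notation Q := (@walk_mx R n m).
Local Notation P := (@stat_mx R n m).
Local Notation C := (@lazy_mx R n m).
Hypothesis msym : forall v w, m v w = m w v.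
Hypothesis mconn : forall v w, connect (fun a b => (0 < m a b)%N) v w.
Hypothesis dpos : forall v, 0 < d v.
Variable x0 : 'I_n.

Lemma nvol_ge0 : 0 <= vol.
Proof. exact: ltW (nvol_gt0 dpos x0). Qed.

Lemma tr_lazy_mx_expr J : \tr (C ^+ (4 * J.+1)) <= 4 * vol / Num.sqrt J.+1%:R.
Proof.
rewrite /mxtrace [4 * _]mulrC -mulrA /nvol mulr_suml; apply: ler_sum => v _.
by rewrite mulrC -ler_pdivrMr // lazy_mx_diag.
Qed.

(** The heat kernel bound is available at multiples of 4 only. As the [mu i] lie in [0, 1], [k] may
    be lowered to [4 (J + 1)]; from [k < 8 (J + 1)] the loss is at most a factor 3, since 8 <= 9. *)
Lemma tr_half_mx_expr_le k : (4 <= k)%N ->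
  forall mu : 'I_n -> R, (forall i, 0 <= mu i <= 1) ->
  (forall k, \tr ((2^-1 *: (1 + (Q - P))) ^+ k) = \sum_i mu i ^+ k) ->
  \sum_i mu i ^+ k <= 3 * (4 * vol + 1) / Num.sqrt k%:R.
Proof.
move=> k4 mu mu01 trE; have v0 := nvol_ge0.
pose J := (k %/ 4).-1; have J4 : (4 * J.+1 <= k < 8 * J.+1)%N by rewrite /J; lia.
have J0 : 0 < J.+1%:R :> R by rewrite ltr0n.
have sJ0 : 0 < Num.sqrt J.+1%:R :> R by rewrite sqrtr_gt0.
have sk0 : 0 < Num.sqrt k%:R :> R by rewrite sqrtr_gt0 ltr0n; lia.
have h1 : \sum_i mu i ^+ k <= \sum_i mu i ^+ (4 * J.+1).
  apply: ler_sum => i _; have /andP[m0 m1] := mu01 i.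
  by apply: ler_wiXn2l => //; case/andP: J4.
have h2 : 2^-1 ^+ (4 * J.+1) <= (Num.sqrt J.+1%:R)^-1 :> R.
  rewrite exprVn lef_pV2 ?posrE ?exprn_gt0 //.
  have sJ1 : 1 <= Num.sqrt J.+1%:R :> R by rewrite -[leLHS]sqrtr1 ler_wsqrtr // ler1n.
  apply: (@le_trans _ _ (J.+1%:R)); first by have := sqr_sqrtr (ltW J0); nra.
  by rewrite -natrX ler_nat; apply: leq_trans (ltnW (ltn_expl _ (isT : (1 < 2)%N))) _;
     rewrite leq_exp2l //; lia.
have h3 : (Num.sqrt J.+1%:R)^-1 <= 3 / Num.sqrt k%:R :> R.
  rewrite ler_pdivlMr // mulrC ler_pdivrMr // -(@ler_pXn2r _ 2) ?nnegrE ?mulr_ge0 ?sqrtr_ge0 //.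
  rewrite exprMn !sqr_sqrtr ?ler0n // -natrX -natrM ler_nat.
  by case/andP: J4 => _ /ltnW /leq_trans; apply; rewrite leq_mul2r; lia.
apply: le_trans h1 _; rewrite -trE.
have -> : (4 * J.+1 = (4 * J.+1).-1.+1)%N by lia.
rewrite (tr_half_mx_expr msym dpos x0) (_ : (4 * J.+1).-1.+1 = 4 * J.+1)%N; last lia.
apply: le_trans (lerD (tr_lazy_mx_expr J) h2) _.
rewrite -[X in _ + X]mul1r -mulrDl [3 * _]mulrC -[leRHS]mulrA ler_wpM2l //; lra.
Qed.

Lemma sum_log_tail_le (l : 'I_n -> R) K : (4 <= K)%N -> (forall i, -1 <= l i < 1) ->
  (forall k, \tr ((2^-1 *: (1 + (Q - P))) ^+ k) = \sum_i ((1 + l i) / 2) ^+ k) ->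
  `|\sum_i log_tail K (l i)| <= n%:R / K.+1%:R + 6 * (4 * vol + 1) / Num.sqrt K%:R.
Proof.
move=> K4 l1 trE; have v0 := nvol_ge0.
rewrite (bigID (fun i => l i <= 0)) /=; apply: le_trans (ler_normD _ _) _; apply: lerD.
  apply: le_trans (ler_norm_sum _ _ _) _.
  apply: (@le_trans _ _ (\sum_(i < n) K.+1%:R^-1)); last first.
    by rewrite sumr_const card_ord mulr_natl.
  rewrite [leRHS](bigID (fun i => l i <= 0)) /= -[leLHS]addr0; apply: lerD.
    by apply: ler_sum => i li; apply: log_tail_neg; rewrite li andbT; case/andP: (l1 i).
  by apply: sumr_ge0.
have l01 i : ~~ (l i <= 0) -> 0 <= l i < 1.
  by rewrite -ltNge => /ltW ->; case/andP: (l1 i).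
rewrite ger0_norm; last by apply: sumr_ge0 => i /l01; exact: log_tail_ge0.
(* The terms between [K] and [M] are bounded by lazy traces, uniformly in [M], because a positive
   eigenvalue satisfies [l i <= (1 + l i) / 2]; afterwards [M] tends to infinity. *)
have main M : (K <= M)%N -> \sum_(i | ~~ (l i <= 0)) log_tail K (l i)
    <= 6 * (4 * vol + 1) / Num.sqrt K%:R + \sum_(i | ~~ (l i <= 0)) log_tail M (l i).
  move=> KM.
  have tE i : log_tail K (l i) = \sum_(K.+1 <= k < M.+1) l i ^+ k / k%:R + log_tail M (l i).
    rewrite /log_tail (@big_cat_nat _ _ _ K.+1 1 M.+1) //=; ring.
  under eq_bigr do rewrite tE.
  rewrite big_split /= lerD2r.
  rewrite exchange_big /=.
  apply: (@le_trans _ _ (\sum_(K.+1 <= k < M.+1)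
      3 * (4 * vol + 1) * (k%:R * Num.sqrt k%:R)^-1)).
    apply: ler_sum_nat => k /andP[Kk _].
    have k0 : 0 < k%:R :> R by rewrite ltr0n; lia.
    rewrite -mulr_suml invfM mulrCA [leRHS]mulrC ler_pM2r ?invr_gt0 //.
    have mu01 i : 0 <= (1 + l i) / 2 <= 1 by have := l1 i; lra.
    apply: le_trans (tr_half_mx_expr_le _ mu01 trE); last lia.
    rewrite [leRHS](bigID (fun i => l i <= 0)) /= addrC -[leLHS]addr0; apply: lerD.
      apply: ler_sum => i /l01 /andP[li0 li1]; apply: lerXn2r; rewrite ?nnegrE //; lra.
    by apply: sumr_ge0 => i _; apply: exprn_ge0; case/andP: (mu01 i).
  rewrite -mulr_sumr.
  have -> : 6 * (4 * vol + 1) / Num.sqrt K%:R = 3 * (4 * vol + 1) * (2 / Num.sqrt K%:R).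
    by ring.
  by rewrite ler_wpM2l ?sum_inv_k_sqrt //; [lra|lia].
apply/ler_addgt0Pr => e e0.
have tail0 : \sum_(i | ~~ (l i <= 0)) log_tail M (l i) @[M --> \oo] --> (0 : R).
  rewrite [X in _ --> X](_ : _ = \sum_(i | ~~ (l i <= 0)) 0); last by rewrite big1.
  apply: cvg_sumr => i /l01 li01; have /andP[li0 li1] := li01.
  apply: (@squeeze_cvgr _ _ _ _ (fun=> 0) (fun M => l i ^+ M * (l i / (1 - l i)))).
  - by apply: nearW => M; rewrite log_tail_ge0 // log_tail_le.
  - exact: cvg_cst.
  - rewrite -[X in _ --> X](mul0r (l i / (1 - l i))); apply: cvgMl.
    by apply: cvg_expr; rewrite ger0_norm.
have /(_ _ e e0) := (proj1 (cvgrPdist_le _ _) tail0); move=> -[N _ NP].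
have := main (maxn K N) (leq_maxl _ _); have := NP (maxn K N) (leq_maxr _ _).
rewrite sub0r normrN => h1 h2; apply: le_trans h2 _; rewrite lerD2l.
exact: le_trans (ler_norm _) h1.
Qed.
End SpectralTail.

Section FiniteGraph.
Variables (R : realType) (G : fmgraph).
Hypotheses (Gl : loopless G) (Gc : fconnected G) (G1 : (1 < nv G)%N).
Local Notation V := 'I_(nv G).
Local Notation d := (@ndeg R (nv G) (@fmult G)).
Local Notation vol := (@nvol R (nv G) (@fmult G)).
Local Notation Q := (@walk_mx R (nv G) (@fmult G)).
Local Notation P := (@stat_mx R (nv G) (@fmult G)).

Lemma fmult_sym (v w : V) : fmult v w = fmult w v.
Proof. by rewrite !fmultE; apply: eq_bigr => e _; rewrite joins_sym. Qed.

Lemma fmult_gt0 (v w : V) : (0 < fmult v w)%N = adjT [set: 'I_(ne G)]%SET v w.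
Proof.
rewrite fmultE lt0n sum_nat_eq0 negb_forall; apply: eq_existsb => e.
by rewrite finset.in_setT /= eqb0 negbK.
Qed.

Lemma fmult_connect (v w : V) : connect (fun a b : V => (0 < fmult a b)%N) v w.
Proof.
rewrite (eq_connect fmult_gt0); case: Gc => _ /forallP/(_ v)/forallP/(_ w).
by [].
Qed.

Lemma ndeg_gt0 (v : V) : 0 < d v.
Proof.
have [w wv] : exists w : V, w != v.
  pose a := Ordinal (ltnW G1); pose b := Ordinal G1.
  by have [<-|] := eqVneq a v; [exists b | exists a].
have /connectP[[|u p] /= vp wE] := fmult_connect v w.
  by rewrite wE eqxx in wv.
case/andP: vp => vu _; rewrite /ndeg ltr0n (bigD1 u) //=; exact: ltn_addr.
Qed.

(** The handshake formula; a loop would be counted once instead of twice, so looplessness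
    matters. *)
Lemma nvolE : vol = (2 * ne G)%:R.
Proof.
rewrite /nvol /ndeg -natr_sum; congr (_%:R).
transitivity (\sum_(v < nv G) \sum_(w < nv G) \sum_(e < ne G) joins e v w)%N.
  by apply: eq_bigr => v _; apply: eq_bigr => w _; rewrite fmultE.
under eq_bigr do rewrite exchange_big /=.
rewrite exchange_big /= (eq_bigr (fun=> 2%N)) ?sum_nat_const ?card_ord 1?mulnC // => e _.
case ee: (ends G e) => [a b]; have ab : a != b by have := Gl e; rewrite ee.
rewrite pair_big /= (bigD1 (a, b)) //= (bigD1 (b, a)) /=; last first.
  by rewrite xpair_eqE negb_and eq_sym ab.
rewrite {1}/joins ee eqxx /= {1}/joins ee eqxx orbT big1 // => -[v w] /=.
rewrite /joins ee => /andP[vw wv]; apply/eqP; rewrite eqb0 negb_or eq_sym vw /=.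
by apply: contra wv => /eqP[-> ->].
Qed.

(** Multiplying row [v] by [d v] turns [1 - Q] into the Laplacian and [P] into a matrix of rank one;
    the update formula then gives the cofactor times the sum of the degrees. *)
Lemma det_walk_mx : \det (1%:M - (Q - P)) * \prod_v d v = vol * (tau G)%:R.
Proof.
pose r : V := Ordinal (ltnW G1).
have v0 : vol != 0 by exact: lt0r_neq0 (nvol_gt0 ndeg_gt0 r).
pose D : 'M[R]_(nv G) := diag_mx (\row_v d v).
have <- : \det D = \prod_v d v by rewrite det_diag; apply: eq_bigr => v _; rewrite mxE.
rewrite mulrC -det_mulmx.
have -> : D *m (1%:M - (Q - P))
    = laplacian G R + (\col_v (d v / vol)) *m (\row_v d v).
  apply/matrixP => v w; rewrite mul_diag_mx !mxE big_ord1 !mxE /gdeg -/(ndeg R (@fmult G) v).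
  have := lt0r_neq0 (ndeg_gt0 v); move: v0; set W := vol; set x := d v => W0 x0.
  by field; apply/andP.
have L1 v : \sum_w laplacian G R v w = 0.
  under eq_bigr do rewrite mxE.
  rewrite sumrB (bigD1 v) //= eqxx mul1r big1 ?addr0; last first.
    by move=> w wv; rewrite eq_sym (negPf wv) mul0r.
  by rewrite /gdeg natr_sum subrr.
rewrite (@det_rank1_update _ _ _ r).
- rewrite det_set_row_sum // matrix_tree; congr (_ * _).
  by apply: eq_bigr => v _; rewrite mxE.
- move=> v; rewrite -[RHS](L1 v); apply: eq_bigr => w _; rewrite !mxE fmult_sym.
  by congr (_ - _); case: eqVneq => [->|]; rewrite ?mul0r.
- under eq_bigr do rewrite mxE.
  by rewrite -mulr_suml divff.
Qed.

(** The exact difference is [- ln vol + H] minus the sum of the remainders, where the harmonic sum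
    [H] is the contribution of the eigenvalue 1. The crude bound [H <= K] suffices, since it will be
    divided by the number of vertices. *)
Lemma ln_tau_estimate K : (4 <= K)%N -> [/\ (0 < tau G)%N &
  `|ln (tau G)%:R - \sum_v (ln (d v) - \sum_(1 <= k < K.+1) (Q ^+ k) v v / k%:R)|
  <= ln vol + K%:R + (nv G)%:R / K.+1%:R + 6 * (4 * vol + 1) / Num.sqrt K%:R].
Proof.
move=> K4; pose r : V := Ordinal (ltnW G1).
have v0 : 0 < vol by exact: nvol_gt0 ndeg_gt0 r.
have v1 : 1 <= vol.
  by rewrite nvolE ler1n; move: v0; rewrite nvolE ltr0n.
have [l [l1 detE trE trE']] := walk_spectrum fmult_sym fmult_connect ndeg_gt0.
have p0 : 0 < \prod_i (1 - l i).
  by apply: prodr_gt0 => i _; rewrite subr_gt0; case/andP: (l1 i).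
have d0 : 0 < \prod_v d v by apply: prodr_gt0 => i _; exact: ndeg_gt0.
have key : \prod_i (1 - l i) * \prod_v d v = vol * (tau G)%:R.
  by rewrite -detE det_walk_mx.
have t0 : 0 < (tau G)%:R :> R by rewrite -(pmulr_rgt0 _ v0) -key mulr_gt0.
split; first by rewrite -(ltr0n R).
have ln_prod (f : V -> R) : (forall i, 0 < f i) -> ln (\prod_i f i) = \sum_i ln (f i).
  move=> f0; suff [] : 0 < \prod_i f i /\ ln (\prod_i f i) = \sum_i ln (f i) by [].
  elim/big_ind2 : _ => [|a b x y [a0 aE] [x0 xE]|i _]; first by rewrite ln1.
    by rewrite mulr_gt0 // lnM ?posrE // aE xE.
  by [].
have lnE : ln (tau G)%:R = \sum_i ln (1 - l i) + \sum_v ln (d v) - ln vol.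
  have l0 i : 0 < 1 - l i by rewrite subr_gt0; case/andP: (l1 i).
  have := congr1 (@ln R) key; rewrite lnM ?posrE // lnM ?posrE //.
  by rewrite (ln_prod _ l0) (ln_prod _ ndeg_gt0) => ->; ring.
pose H : R := \sum_(1 <= k < K.+1) k%:R^-1.
have trQ : \sum_v \sum_(1 <= k < K.+1) (Q ^+ k) v v / k%:R
    = \sum_i \sum_(1 <= k < K.+1) l i ^+ k / k%:R + H.
  rewrite exchange_big /= [X in _ = X + _]exchange_big /= /H -big_split /=.
  rewrite big_nat_cond [RHS]big_nat_cond; apply: eq_bigr => -[|k] // _.
  rewrite -!mulr_suml -trE -/(mxtrace (Q ^+ k.+1)).
  by rewrite (tr_walk_mx_expr fmult_sym ndeg_gt0 r) mulrDl mul1r.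
have -> : ln (tau G)%:R - \sum_v (ln (d v) - \sum_(1 <= k < K.+1) (Q ^+ k) v v / k%:R)
    = - ln vol + H - \sum_i log_tail K (l i).
  rewrite sumrB trQ lnE.
  have -> : \sum_i log_tail K (l i)
      = - \sum_i ln (1 - l i) - \sum_i \sum_(1 <= k < K.+1) l i ^+ k / k%:R.
    by rewrite -!sumrN -big_split.
  ring.
have H0 : 0 <= H by apply: sumr_ge0 => k _; rewrite invr_ge0.
have HK : H <= K%:R.
  rewrite /H big_add1 /= big_mkord -[leRHS]mulr1 -[K in leRHS]card_ord.
  rewrite mulr_natl -sumr_const; apply: ler_sum => i _.
  by rewrite invf_le1 ?ler1n.
have lv : 0 <= ln vol by rewrite ln_ge0.
have := sum_log_tail_le fmult_sym fmult_connect ndeg_gt0 r K4 l1 trE'.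
move: ((nv G)%:R / K.+1%:R) (6 * (4 * vol + 1) / Num.sqrt K%:R) => A B.
move: (\sum_i log_tail K (l i)) (ln vol) (K%:R) lv H0 HK => S L k lv H0 HK.
by rewrite !ler_norml => /andP[S1 S2]; apply/andP; split; lra.
Qed.
End FiniteGraph.

(** * Functionals of balls and random weak limits *)

Lemma sum_cover (R : nmodType) (V : finType) N (f : 'I_N -> V) (F : V -> R) :
  injective f -> (forall y, F y != 0 -> exists i, f i = y) ->
  \sum_y F y = \sum_i F (f i).
Proof.
move=> fI fF; rewrite (bigID (mem (codom f))) /= [X in _ + X]big1 ?addr0; last first.
  move=> y yf; apply/eqP; apply: contraNT yf => /fF[i <-]; exact: codom_f.
rewrite -big_uniq /=; last by rewrite map_inj_uniq // enum_uniq.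
by rewrite big_map big_enum.
Qed.

(** The partial sums are eventually constant. This evaluates the limits by which [deg] and [walk]
    are defined. *)
Lemma limn_cover (R : realType) N (f : 'I_N -> nat) (F : nat -> R) :
  injective f -> (forall y, F y != 0 -> exists i, f i = y) ->
  limn (fun M : nat => \sum_(y < M) F y) = \sum_i F (f i).
Proof.
move=> fI fF; apply: cvg_lim => //; apply: cvg_near_cst.
pose B := (\max_(i < N) f i).+1; exists B => // M /= BM.
have fM i : (f i < M)%N by apply: leq_trans BM; rewrite ltnS; exact: leq_bigmax.
apply: (sum_cover (f := fun i => Ordinal (fM i))).
  by move=> i j /(congr1 val)/fI.
by move=> y /fF[i fi]; exists i; apply: val_inj.
Qed.

Section Within.
Variables (V : Type) (m : V -> V -> nat).

Lemma within_leq (o v : V) k r : (k <= r)%N -> within m k o v -> within m r o v.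
Proof.
by elim: r => [|r IH]; [rewrite leqn0 => /eqP->|rewrite leq_eqVlt => /orP[/eqP->//|/IH h /h]; left].
Qed.

Lemma within_step (o v w : V) k : within m k o v -> (0 < m v w)%N -> within m k.+1 o w.
Proof. by move=> ov vw; right; exists v. Qed.
End Within.

(** * Degrees and return probabilities are functions of a ball *)

Section LocalWalk.
Variables (R : realType) (V : Type) (m : V -> V -> nat) (o : V).
Variables (dg : V -> R) (w : nat -> V -> R).
Hypothesis dgE : forall N (f : 'I_N -> V) z, injective f ->
  (forall y, (0 < m z y)%N -> exists i, f i = y) -> dg z = \sum_i (m z (f i))%:R.
Hypothesis w0o : w 0 o = 1.
Hypothesis w0 : forall y, w 0 y <> 0 -> y = o.
Hypothesis wS : forall N (f : 'I_N -> V) k y, injective f ->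
  (forall z, w k z != 0 -> exists i, f i = z) ->
  w k.+1 y = \sum_i w k (f i) * ((m (f i) y)%:R / dg (f i)).
Variables (r k : nat) (mH : 'I_k -> 'I_k -> nat) (rH : 'I_k) (f : 'I_k -> V).
Hypotheses (fI : injective f) (fr : f rH = o)
  (fB : forall v, within m r o v <-> exists i, f i = v)
  (fm : forall i j, mH i j = m (f i) (f j)).

Lemma local_deg j i : (j < r)%N -> within m j o (f i) -> dg (f i) = ndeg R mH i.
Proof.
move=> jr oi; rewrite (dgE fI) => [|y iy].
  by rewrite /ndeg natr_sum; apply: eq_bigr => l _; rewrite fm.
by apply/fB; apply: within_leq jr _; exact: within_step iy.
Qed.

(** After [j] steps the walk is within distance [j]. Step [j + 1 <= r] uses degrees only at distance
    less than [r], where the ball contains all neighbours; on the boundary the degree in [mH] may be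
    too small. The abstract [w] and [dg] cover both the limits on [nat] and the finite matrices. *)
Lemma local_walk j : (j <= r)%N ->
  (forall z, w j z != 0 -> within m j o z) /\
  forall i, w j (f i) = (walk_mx R mH ^+ j) rH i.
Proof.
elim: j => [|j IH] jr.
  split=> [z /eqP /w0 -> //|i]; rewrite expr0 mxE; case: eqVneq => [<-|ri].
    by rewrite fr w0o.
  by apply/eqP; apply: contraNT ri => /eqP /w0; rewrite -fr => /fI ->.
have [supp wE] := IH (ltnW jr).
have cov z : w j z != 0 -> exists i, f i = z.
  by move=> /supp oz; apply/fB; apply: within_leq oz; exact: ltnW.
split=> [z|i]; rewrite (wS _ fI cov).
  move=> nz; apply: contrapT => noz; move/eqP: nz; apply; apply: big1 => i _.
  have [->|wi] := eqVneq (w j (f i)) 0; first by rewrite mul0r.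
  have [->|mi] := posnP (m (f i) z); first by rewrite mul0r mulr0.
  by case: noz; exact: within_step (supp _ wi) mi.
rewrite exprSr -mulmxE mxE; apply: eq_bigr => l _; rewrite -wE mxE -fm.
have [->|wl] := eqVneq (w j (f l)) 0; first by rewrite !mul0r.
by rewrite (local_deg jr (supp _ wl)).
Qed.

Lemma local_return j : (j <= r)%N -> w j o = (walk_mx R mH ^+ j) rH rH.
Proof. by move=> /local_walk[_ <-]; rewrite fr. Qed.

Lemma local_root_deg : (0 < r)%N -> dg o = ndeg R mH rH.
Proof. by move=> r0; rewrite -fr; apply: (@local_deg 0%N) => //=; rewrite fr. Qed.
End LocalWalk.

Section LocalFunctionals.
Variables (R : realType) (r k : nat) (mH : 'I_k -> 'I_k -> nat) (rH : 'I_k).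

Lemma ret_prob_local (g : rgraph) j : (j <= r)%N -> ball_iso g 0%N r mH rH ->
  ret_prob g j 0%N = (walk_mx R mH ^+ j) rH rH.
Proof.
move=> jr [f [fI fr fB fm]].
apply: (@local_return R nat g 0%N (deg g) (fun j => walk g 0%N j) _ _ _ _ r k mH rH f) => //.
- move=> N h z hI hz; apply: (limn_cover (F := fun y => (g z y)%:R)) => // y.
  by rewrite pnatr_eq0 -lt0n; exact: hz.
- by move=> y /=; case: eqP.
- move=> N h i y hI hz; 
  apply: (limn_cover (F := fun z => walk g 0%N i z * ((g z y)%:R / deg g z))) => // z.
  by move=> nz; apply: hz; apply: contraNneq nz => ->; rewrite mul0r.
Qed.

Lemma deg_local (g : rgraph) : (0 < r)%N -> ball_iso g 0%N r mH rH ->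
  deg g 0%N = ndeg R mH rH.
Proof.
move=> r0 [f [fI fr fB fm]].
apply: (@local_root_deg R nat g 0%N (deg g) _ r k mH rH f) => //.
move=> N h z hI hz; apply: (limn_cover (F := fun y => (g z y)%:R)) => // y.
by rewrite pnatr_eq0 -lt0n; exact: hz.
Qed.

Lemma fin_deg_cover n (m : 'I_n -> 'I_n -> nat) N (h : 'I_N -> 'I_n) z : injective h ->
  (forall y, (0 < m z y)%N -> exists i, h i = y) -> ndeg R m z = \sum_i (m z (h i))%:R.
Proof.
move=> hI hz; rewrite /ndeg natr_sum; apply: sum_cover => // y.
by rewrite pnatr_eq0 -lt0n; exact: hz.
Qed.

Lemma walk_mx_local n (m : 'I_n -> 'I_n -> nat) (x : 'I_n) j : (j <= r)%N ->
  ball_iso m x r mH rH -> (walk_mx R m ^+ j) x x = (walk_mx R mH ^+ j) rH rH.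
Proof.
move=> jr [f [fI fr fB fm]].
apply: (@local_return R 'I_n m x (ndeg R m) (fun j y => (walk_mx R m ^+ j) x y)
  _ _ _ _ r k mH rH f) => //.
- exact: fin_deg_cover.
- by rewrite expr0 mxE eqxx.
- by move=> y; rewrite expr0 mxE; case: eqP.
- move=> N h i y hI hz; rewrite exprSr -mulmxE mxE (sum_cover hI).
    by apply: eq_bigr => l _; rewrite [walk_mx _ _ _ _]mxE.
  by move=> z nz; apply: hz; apply: contraNneq nz => ->; rewrite mul0r.
Qed.

Lemma ndeg_local n (m : 'I_n -> 'I_n -> nat) (x : 'I_n) : (0 < r)%N ->
  ball_iso m x r mH rH -> ndeg R m x = ndeg R mH rH.
Proof.
move=> r0 [f [fI fr fB fm]].
apply: (@local_root_deg R 'I_n m x (ndeg R m) _ r k mH rH f) => //.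
exact: fin_deg_cover.
Qed.
End LocalFunctionals.

(** Finite functions in place of functions make the type countable, so that [pickle] applies. *)
Definition rooted_code := {k : nat & ({ffun 'I_k -> {ffun 'I_k -> nat}} * 'I_k)%type}.

Definition code_mult (H : rooted_code) : 'I_(tag H) -> 'I_(tag H) -> nat :=
  fun i j => (tagged H).1 i j.
Definition code_root (H : rooted_code) : 'I_(tag H) := (tagged H).2.

(* Natural numbers enumerate the finite rooted graphs with repetitions up to isomorphism;
   [ball_code] selects the least index of the isomorphism class of the ball. *)
Definition has_ball (V : Type) (m : V -> V -> nat) (o : V) (r N : nat) : Prop :=
  exists2 H : rooted_code, unpickle N = Some H & ball_iso m o r (@code_mult H) (code_root H).

Definition ball_code (V : Type) (m : V -> V -> nat) (o : V) (r N : nat) : Prop :=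
  has_ball m o r N /\ forall M, (M < N)%N -> ~ has_ball m o r M.

Lemma has_ball_exists (V : choiceType) (m : V -> V -> nat) (o : V) r :
  finite_set [set v | within m r o v] -> exists N, has_ball m o r N.
Proof.
move=> /finite_seqP[s0 sE]; pose s := undup s0.
have sP v : within m r o v <-> v \in s.
  have := congr1 (fun A : set V => A v) sE; rewrite /s mem_undup /= => ->; exact: iff_refl.
have os : (index o s < size s)%N by rewrite index_mem; apply/sP; exact: (@within_leq _ m o o 0 r).
pose f (i : 'I_(size s)) := nth o s i.
pose H : rooted_code := Tagged (fun k => ({ffun 'I_k -> {ffun 'I_k -> nat}} * 'I_k)%type)
  ([ffun i => [ffun j => m (f i) (f j)]], Ordinal os).
exists (pickle H), H; first exact: pickleK.
exists f; split.
- move=> i j /eqP; rewrite nth_uniq ?undup_uniq // => /eqP; exact: val_inj.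
- by rewrite /f /= nth_index // -index_mem.
- move=> v; split=> [/sP vs|[i <-]]; last by apply/sP; exact: mem_nth.
  have vs' : (index v s < size s)%N by rewrite index_mem.
  by exists (Ordinal vs'); rewrite /f /= nth_index.
- by move=> i j; rewrite /code_mult /= !ffunE.
Qed.

Lemma ball_code_of_has_ball (V : Type) (m : V -> V -> nat) (o : V) r N :
  has_ball m o r N -> exists M, ball_code m o r M.
Proof.
elim/ltn_ind: N => N IH hN.
have [[M MN hM]|nM] := pselect (exists2 M, (M < N)%N & has_ball m o r M); first exact: IH hM.
by exists N; split=> // M MN hM; apply: nM; exists M.
Qed.

Lemma ball_code_exists (V : choiceType) (m : V -> V -> nat) (o : V) r :
  finite_set [set v | within m r o v] -> exists N, ball_code m o r N.
Proof. by move=> /has_ball_exists[N hN]; exact: ball_code_of_has_ball hN. Qed.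

Lemma ball_code_uniq (V : Type) (m : V -> V -> nat) (o : V) r N M :
  ball_code m o r N -> ball_code m o r M -> N = M.
Proof.
move=> [hN N_min] [hM M_min]; case: (ltngtP N M) => // NM.
  by case: (M_min _ NM).
by case: (N_min _ NM).
Qed.

Lemma ball_iso_transfer (V V' : Type) (m : V -> V -> nat) (o : V)
    (m' : V' -> V' -> nat) (o' : V') r k (mH : 'I_k -> 'I_k -> nat) rH
    k' (mH' : 'I_k' -> 'I_k' -> nat) rH' :
  ball_iso m o r mH rH -> ball_iso m o r mH' rH' ->
  ball_iso m' o' r mH rH -> ball_iso m' o' r mH' rH'.
Proof.
move=> [f [fI fr fB fm]] [f' [fI' fr' fB' fm']] [g [gI gr gB gm]].
have tE (i : 'I_k') : exists j : 'I_k, f j = f' i by apply/fB/fB'; exists i.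
have [t tP] := choice tE.
have tr : t rH' = rH by apply: fI; rewrite tP fr' fr.
exists (g \o t); split.
- by move=> i j /= /gI tij; apply: fI'; rewrite -!tP tij.
- by rewrite /= tr.
- move=> v; split=> [/gB[i <-]|[i <-]]; last by apply/gB; exists (t i).
  have /fB'[j fj] : within m r o (f i) by apply/fB; exists i.
  by exists j; congr g; apply: fI; rewrite tP.
- by move=> i j /=; rewrite -gm fm !tP -fm'.
Qed.

Lemma has_ball_transfer (V V' : Type) (m : V -> V -> nat) (o : V)
    (m' : V' -> V' -> nat) (o' : V') r N N' :
  has_ball m o r N -> has_ball m o r N' -> has_ball m' o' r N -> has_ball m' o' r N'.
Proof.
move=> [H NH mH] [H2 NH2 mH2] [H1]; rewrite NH => -[<-] m1H.
by exists H2 => //; exact: ball_iso_transfer mH mH2 m1H.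
Qed.

(** Being the least index of an isomorphism class depends on [N] and [r] alone, not on the graph
    whose ball is inspected. *)
Lemma ball_code_dichotomy r N :
  (forall (V : Type) (m : V -> V -> nat) (o : V), has_ball m o r N <-> ball_code m o r N) \/
  (forall (V : Type) (m : V -> V -> nat) (o : V), ~ ball_code m o r N).
Proof.
have [[V [m [x [hN N_min]]]]|noN] :=
    pselect (exists (V : Type) (m : V -> V -> nat) (o : V), ball_code m o r N); [left|right].
  move=> V' m' o'; split=> [hN'|[]//]; split=> // M MN hM.
  by apply: (N_min _ MN); exact: has_ball_transfer hN' hM hN.
by move=> V m o cN; apply: noN; exists V, m, o.
Qed.

Lemma young_weight (R : realFieldType) (x del : R) : 0 < del ->
  `|x| <= del * x ^+ 2 + del^-1.
Proof.
move=> d0; rewrite -real_normK ?num_real //; have [x1|/ltW x1] := leP `|x| del^-1.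
  by apply: le_trans x1 _; rewrite lerDr mulr_ge0 ?sqr_ge0 // ltW.
apply: (@le_trans _ _ (del * `|x| ^+ 2)); last by rewrite lerDl invr_ge0 ltW.
by rewrite expr2 mulrA ler_peMl // mulrC -ler_pdivrMr // div1r.
Qed.

(* Uniformly bounded second moments make the tails of the first moments uniformly small. *)
Lemma weighted_cvg (R : realType) (a : nat -> nat -> R) (b : nat -> R) (phi : nat -> R)
    (B : nat -> nat) (C I : R) :
  (forall n N, 0 <= a n N) -> (forall N, a n N @[n --> \oo] --> b N) ->
  (forall n N, (B n <= N)%N -> a n N = 0) -> (forall n, \sum_(N < B n) a n N = 1) ->
  (forall n, \sum_(N < B n) phi N ^+ 2 * a n N <= C) ->
  \sum_(N < M) b N @[M --> \oo] --> (1 : R) ->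
  \sum_(N < M) phi N * b N @[M --> \oo] --> I ->
  \sum_(N < B n) phi N * a n N @[n --> \oo] --> I.
Proof.
move=> a0 ab aB a1 aC b1 bI; apply/cvgrPdist_le => e e0.
have C0 : 0 <= C.
  by apply: le_trans (aC 0); apply: sumr_ge0 => N _; rewrite mulr_ge0 ?sqr_ge0.
(* In the tail [|phi| <= del * phi ^ 2 + del^-1]: this [del] makes the first part at most e/4, and a
   tail mass of at most [e / 4 * del] does the same for the second. That mass is split equally
   between the tail of [b] and the distance from [b] to [a n]. *)
pose del := e / (4 * (C + 1)).
have C1 : 0 < C + 1 by lra.
have del0 : 0 < del by rewrite divr_gt0 ?mulr_gt0.
have delC : del * C <= e / 4.
  rewrite /del; have -> : e / (4 * (C + 1)) * C = e / 4 * (C / (C + 1)) by field; lra.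
  by rewrite ler_piMr ?divr_ge0 ?(ltW e0) // ler_pdivrMr // mul1r; lra.
have edel : 0 < e / 8 * del by rewrite mulr_gt0 // divr_gt0.
have [N0 _ N0P] : \forall M \near \oo,
    `|1 - \sum_(N < M) b N| <= e / 8 * del /\ `|I - \sum_(N < M) phi N * b N| <= e / 4.
  near=> M; split; near: M.
    exact: (proj1 (cvgrPdist_le _ _) b1).
  by apply: (proj1 (cvgrPdist_le _ _) bI); rewrite divr_gt0.
have [h1 h2] := N0P N0 (leqnn _).
have c1 : \sum_(N < N0) a n N @[n --> \oo] --> \sum_(N < N0) b N.
  by apply: cvg_sumr => N _; exact: ab.
have c2 : \sum_(N < N0) phi N * a n N @[n --> \oo] --> \sum_(N < N0) phi N * b N.
  by apply: cvg_sumr => N _; apply: cvgMr; exact: ab.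
have d1 := proj1 (cvgrPdist_le _ _) c1 _ edel.
have d2 := proj1 (cvgrPdist_le _ _) c2 (e / 4) (divr_gt0 e0 (ltr0Sn _ _)).
near=> n.
have k1 : `|\sum_(N < N0) b N - \sum_(N < N0) a n N| <= e / 8 * del.
  by near: n; exact: d1.
have k2 : `|\sum_(N < N0) phi N * b N - \sum_(N < N0) phi N * a n N| <= e / 4.
  by near: n; exact: d2.
pose L := maxn (B n) N0.
have ext (F : nat -> R) : \sum_(N < B n) F N * a n N
    = \sum_(0 <= N < N0) F N * a n N + \sum_(N0 <= N < L) F N * a n N.
  rewrite -big_cat_nat ?leq_maxr //= -(big_mkord xpredT (fun N => F N * a n N)).
  rewrite [RHS](@big_cat_nat _ _ _ (B n)) ?leq_maxl //= [X in _ + X]big_nat_cond.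
  by rewrite [X in _ + X]big1 ?addr0 // => N /andP[/andP[/aB -> _] _]; rewrite mulr0.
have tot : \sum_(N0 <= N < L) a n N = 1 - \sum_(N < N0) a n N.
  have e1 : \sum_(N < B n) 1 * a n N = 1 by under eq_bigr do rewrite mul1r; exact: a1.
  have e2 s t : \sum_(s <= N < t) 1 * a n N = \sum_(s <= N < t) a n N.
    by apply: eq_bigr => N _; rewrite mul1r.
  by move: e1; rewrite (ext (fun=> 1)) !e2 big_mkord => <-; rewrite addrAC subrr add0r.
have tail : `|\sum_(N0 <= N < L) phi N * a n N|
    <= del * C + del^-1 * (1 - \sum_(N < N0) a n N).
  rewrite -tot; apply: le_trans (ler_norm_sum _ _ _) _.
  apply: (@le_trans _ _ (del * \sum_(N0 <= N < L) phi N ^+ 2 * a n N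
      + del^-1 * \sum_(N0 <= N < L) a n N)).
    rewrite !mulr_sumr -big_split /=; apply: ler_sum => N _.
    rewrite normrM (ger0_norm (a0 n N)) mulrA -mulrDl.
    by apply: ler_wpM2r => //; exact: young_weight.
  rewrite lerD2r ler_wpM2l ?(ltW del0) //; apply: le_trans (aC n).
  rewrite (ext (fun N => phi N ^+ 2)) lerDr; apply: sumr_ge0 => N _.
  by rewrite mulr_ge0 ?sqr_ge0.
have tail' : del^-1 * (1 - \sum_(N < N0) a n N) <= e / 4.
  rewrite mulrC ler_pdivrMr //; move: h1 k1; rewrite !ler_norml; lra.
rewrite (ext phi) big_mkord; move: h2 k2 tail; rewrite !ler_norml.
by move=> /andP[? ?] /andP[? ?] /andP[? ?]; apply/andP; split; lra.
Unshelve. all: by end_near.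
Qed.

(** * Measurability of events on rooted graphs *)

Section MeasurablePredicates.
Variables (d : measure_display) (T : measurableType d).
Implicit Types P Q : T -> Prop.

Lemma measurable_const (p : Prop) : measurable [set _ : T | p].
Proof.
have [hp|np] := pselect p.
  by rewrite (_ : [set _ | _] = setT) //; apply/seteqP; split.
by rewrite (_ : [set _ | _] = set0) //; apply/seteqP; split.
Qed.

Lemma measurable_not P : measurable [set t | P t] -> measurable [set t | ~ P t].
Proof. exact: measurableC. Qed.

Lemma measurable_and P Q : measurable [set t | P t] -> measurable [set t | Q t] ->
  measurable [set t | P t /\ Q t].
Proof. exact: measurableI. Qed.

Lemma measurable_or P Q : measurable [set t | P t] -> measurable [set t | Q t] ->
  measurable [set t | P t \/ Q t].
Proof. exact: measurableU. Qed.

Lemma measurable_ex (I : countType) (P : I -> T -> Prop) :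
  (forall i, measurable [set t | P i t]) -> measurable [set t | exists i, P i t].
Proof.
move=> mP; rewrite (_ : [set t | _] =
  \bigcup_(n in @setT nat) (if unpickle n is Some i then [set t | P i t] else set0)).
  by apply: bigcup_measurable => n _; case: unpickle.
apply/seteqP; split=> [t [i Pit]|t [n _]].
  by exists (pickle i) => //; rewrite pickleK.
by case: unpickle => // i Pit; exists i.
Qed.

Lemma measurable_all (I : countType) (P : I -> T -> Prop) :
  (forall i, measurable [set t | P i t]) -> measurable [set t | forall i, P i t].
Proof.
move=> mP; rewrite (_ : [set t | _] = [set t | ~ exists i, ~ P i t]).
  by apply: measurable_not; apply: measurable_ex => i; exact: measurable_not.
by apply/seteqP; split=> t /=; rewrite -forallNP; [move=> Pt i /(_ (Pt i))|
  move=> Pt i; apply: contrapT; exact: Pt].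
Qed.

Lemma measurable_imply (p : Prop) P : measurable [set t | P t] ->
  measurable [set t | p -> P t].
Proof.
move=> mP; rewrite (_ : [set t | _] = [set t | ~ p \/ P t]).
  by apply: measurable_or => //; exact: measurable_const.
apply/seteqP; split=> t /=; last by move=> [np|].
by move=> h; have [hp|] := pselect p; [right; exact: h | left].
Qed.

Lemma measurable_iff P Q : measurable [set t | P t] -> measurable [set t | Q t] ->
  measurable [set t | P t <-> Q t].
Proof.
move=> mP mQ; rewrite (_ : [set t | _] = [set t | (P t /\ Q t) \/ (~ P t /\ ~ Q t)]).
  by apply: measurable_or; apply: measurable_and => //; exact: measurable_not.
apply/seteqP; split=> t /=; last by move=> [[]|[]].
by move=> [pq qp]; have [p|np] := pselect (P t); [left; split=> //; exact: pq |
  right; split=> // /qp].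
Qed.
End MeasurablePredicates.

Section RootedGraphEvents.

Lemma measurable_mult (p : nat -> Prop) x y : measurable [set g : RG | p (g x y)].
Proof.
rewrite (_ : [set g | _] = [set g : RG | exists j, p j /\ g x y = j]).
  apply: measurable_ex => j; apply: measurable_and; first exact: measurable_const.
  by apply: sub_sigma_algebra; exists x, y, j.
by apply/seteqP; split=> g /=; [move=> pg; exists (g x y) | move=> [j [pj ->]]].
Qed.

Lemma measurable_within r v : measurable [set g : RG | within g r 0%N v].
Proof.
elim: r v => [|r IH] v /=; first exact: measurable_const.
apply: measurable_or => //; apply: measurable_ex => z.
by apply: measurable_and => //; exact: (@measurable_mult (fun j => (0 < j)%N)).
Qed.

Lemma measurable_ball_iso r k (mH : 'I_k -> 'I_k -> nat) (rH : 'I_k) :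
  measurable [set g : RG | ball_iso g 0%N r mH rH].
Proof.
(* Embeddings written as finite functions form a countable type, so their existence is a countable
   union. *)
pose P (f : {ffun 'I_k -> nat}) (g : RG) := injective f /\ (f rH = 0%N /\
  ((forall v, within g r 0%N v <-> exists i, f i = v) /\
  (forall i j, mH i j = g (f i) (f j)))).
rewrite (_ : [set g | _] = [set g : RG | exists f, P f g]).
  apply: measurable_ex => f; do 3?[apply: measurable_and]; do ?exact: measurable_const.
    apply: measurable_all => v; apply: measurable_iff; last exact: measurable_const.
    exact: measurable_within.
  apply: measurable_all => i; apply: measurable_all => j.
  exact: (@measurable_mult (fun l => mH i j = l)).
apply/seteqP; split=> g /=.
  move=> [f [fI fr fB fm]]; exists (finfun f); rewrite /P.
  have fE i : finfun f i = f i by rewrite ffunE.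
  split; first by move=> i j; rewrite !fE => /fI.
  split; first by rewrite fE.
  split=> [v|i j]; last by rewrite !fE.
  by rewrite fB; split=> -[i <-]; exists i.
by move=> [f [fI [fr [fB fm]]]]; exists f; split.
Qed.

Lemma measurable_has_ball r N : measurable [set g : RG | has_ball g 0%N r N].
Proof.
rewrite /has_ball; case: (unpickle N) => [H|].
  rewrite (_ : [set g | _] = [set g : RG | ball_iso g 0%N r (@code_mult H) (code_root H)]).
    exact: measurable_ball_iso.
  by apply/seteqP; split=> g /=; [move=> [_ [<-]] | exists H].
rewrite (_ : [set g | _] = set0) //.
by apply/seteqP; split=> g // -[].
Qed.

Lemma measurable_ball_code r N : measurable [set g : RG | ball_code g 0%N r N].
Proof.
apply: measurable_and; first exact: measurable_has_ball.
apply: measurable_all => M; apply: measurable_imply; apply: measurable_not.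
exact: measurable_has_ball.
Qed.

Definition good_graph : set RG := [set g : RG | valid_graph g /\ root_comp_infinite g].

Lemma infinite_nat_setP (A : set nat) :
  infinite_set A <-> forall N, exists v, (N <= v)%N /\ A v.
Proof.
split=> [Ainf N|h Afin].
  apply: contrapT => /forallNP nA; apply: Ainf.
  apply: (@sub_finite_set _ _ `I_N) => // v Av /=.
  by rewrite ltnNge; apply/negP => Nv; apply: (nA v).
have /finite_seqP[s sE] := Afin.
have [v [sv Av]] := h (\max_(i <- s) i).+1.
have vs : v \in s by have : [set` s] v by rewrite -sE.
have := @leq_bigmax_seq _ s xpredT id v vs isT.
by rewrite /= leqNgt sv.
Qed.

Lemma measurable_good_graph : measurable good_graph.
Proof.
apply: measurable_and.
  rewrite (_ : [set g | _] = [set g : RG | (forall x y, g x y = g y x) /\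
     ((forall x, g x x = 0%N) /\
     (forall x, exists N, forall y, (N <= y)%N -> g x y = 0%N))]); last first.
    by apply/seteqP; split=> g /=; [move=> [] | move=> [? []]; split].
  apply: measurable_and; [|apply: measurable_and].
  - apply: measurable_all => x; apply: measurable_all => y.
    rewrite (_ : [set g | _] = [set g : RG | exists j, g x y = j /\ g y x = j]).
      apply: measurable_ex => j.
      by apply: measurable_and; exact: (@measurable_mult (fun l => l = j)).
    apply/seteqP; split=> g /=; first by exists (g x y).
    by move=> [j [-> ->]].
  - by apply: measurable_all => x; exact: (@measurable_mult (fun l => l = 0%N)).
  - apply: measurable_all => x; apply: measurable_ex => N; apply: measurable_all => y.
    by apply: measurable_imply; exact: (@measurable_mult (fun l => l = 0%N)).
rewrite (_ : [set g | _] = [set g : RG | forall N, exists v,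
    (N <= v)%N /\ exists r, within g r 0%N v]).
  apply: measurable_all => N; apply: measurable_ex => v; apply: measurable_and.
    exact: measurable_const.
  by apply: measurable_ex => r; exact: measurable_within.
by apply/seteqP; split=> g /=; rewrite /root_comp_infinite infinite_nat_setP.
Qed.

Lemma finite_ball (g : rgraph) r : valid_graph g ->
  finite_set [set v | within g r 0%N v].
Proof.
move=> [_ _ gfin]; elim: r => [|r IH] /=.
  by rewrite (_ : [set v | _] = [set 0%N]) //; apply/seteqP; split=> v /= ->.
rewrite (_ : [set v | _] = [set v | within g r 0%N v] `|`
    \bigcup_(z in [set z | within g r 0%N z]) [set v | (0 < g z v)%N]).
  rewrite finite_setU; split=> //; apply: bigcup_finite => // z _.
  have [N zN] := gfin z; apply: (@sub_finite_set _ _ `I_N) => // v /=.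
  by move=> gv; rewrite ltnNge; apply/negP => /zN vz; rewrite vz in gv.
apply/seteqP; split=> v /=.
  by move=> [|[z [? ?]]]; [left | right; exists z].
by move=> [|[z ? ?]]; [left | right; exists z].
Qed.

End RootedGraphEvents.

Section FullMeasure.
Import HBNNSimple.
Local Open Scope ereal_scope.
Variables (d : measure_display) (T : measurableType d) (R : realType).
Variables (mu : {measure set T -> \bar R}) (W : set T).
Hypotheses (mW : measurable W) (muW : mu (~` W) = 0).

(* The null set is removed from the simple functions below [F], which are measurable even if [F] is not. *)
Lemma ge0_integral_full (F : T -> \bar R) : (forall x, 0 <= F x) ->
  \int[mu]_x F x = \int[mu]_(x in W) F x.
Proof.
move=> F0; rewrite !ge0_integralE //; apply/eqP; rewrite eq_le; apply/andP; split.
  apply: ge_ereal_sup => _ [h hF <-]; rewrite -integralT_nnsfun.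
  rewrite (@ge0_negligible_integral _ _ _ mu setT (~` W)) //; last 3 first.
  - exact: measurableC.
  - exact/measurable_EFinP.
  - by move=> x _; rewrite lee_fin.
  rewrite setDE setTI setCK ge0_integralE; last by move=> x _; rewrite lee_fin.
  apply: ge_ereal_sup => _ [g gh <-]; apply: ereal_sup_ubound; exists g => // x.
  apply: le_trans (gh x) _; rewrite /patch; case: ifPn => // _.
  by have := hF x; rewrite patch_setT.
apply: ge_ereal_sup => _ [h hF <-]; apply: ereal_sup_ubound; exists h => // x.
rewrite patch_setT; apply: le_trans (hF x) _.
by rewrite /patch; case: ifPn.
Qed.

(** No measurability of [F] is assumed: the entropy integrand is controlled on [good_graph] only. *)
Lemma integral_full (F : T -> \bar R) : \int[mu]_x F x = \int[mu]_(x in W) F x.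
Proof.
by rewrite integralE [RHS]integralE !ge0_integral_full.
Qed.
End FullMeasure.

(** * Integrals of local functionals as sums over isomorphism types of balls *)

Section CodeIntegral.
Variables (R : realType) (rho : probability RG R) (r : nat).
Hypothesis rhoW : on_rooted_infinite rho.

Definition code_set N : set RG := good_graph `&` [set g : RG | ball_code g 0%N r N].
Definition code_prob N : R := fine (rho (code_set N)).

Lemma measurable_code_set N : measurable (code_set N).
Proof. by apply: measurableI; [exact: measurable_good_graph | exact: measurable_ball_code]. Qed.

Lemma rho_notgood : rho (~` good_graph) = 0%E.
Proof.
have := probability_setC rho measurable_good_graph.
by rewrite [X in (1 - X)%E]rhoW => ->; rewrite subee.
Qed.

Lemma rho_good (E : set RG) : measurable E -> rho (good_graph `&` E) = rho E.
Proof.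
move=> mE; have mW := measurable_good_graph; apply/eqP; rewrite eq_le; apply/andP; split.
  by apply: le_measure; rewrite ?inE; [exact: measurableI | exact: mE | exact: subIsetr].
apply: (@le_trans _ _ (rho ((good_graph `&` E) `|` ~` good_graph))).
  apply: le_measure; rewrite ?inE; first exact: mE.
    by apply: measurableU; [exact: measurableI | exact: measurableC].
  by move=> g Eg; have [gW|gW] := pselect (good_graph g); [left|right].
apply: le_trans (measureU2 _ _ _) _; [exact: measurableI | exact: measurableC |].
by rewrite [X in (_ + X <= _)%E]rho_notgood adde0.
Qed.

Lemma code_prob_ge0 N : 0 <= code_prob N.
Proof. by apply: fine_ge0. Qed.

Lemma code_probE N : (code_prob N)%:E = rho (code_set N).
Proof. by rewrite fineK // fin_num_measure //; exact: measurable_code_set. Qed.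

Lemma trivIset_code : trivIset setT code_set.
Proof.
apply/trivIsetP => N M _ _ NM; apply/seteqP; split=> // g [[_ gN] [_ gM]].
by move/eqP: NM; apply; exact: ball_code_uniq gN gM.
Qed.

Lemma bigcup_code : \bigcup_N code_set N = good_graph.
Proof.
apply/seteqP; split=> [g [N _ []]//|g gW].
have [N gN] := ball_code_exists (finite_ball r (proj1 gW)).
by exists N.
Qed.

(** Balls in a locally finite graph are finite, so the types partition [good_graph] and no mass
    escapes. This is the tightness required by [weighted_cvg]. *)
Lemma sum_code_prob : \sum_(N < M) code_prob N @[M --> \oo] --> (1 : R).
Proof.
have mU : measurable (\bigcup_N code_set N) by rewrite bigcup_code; exact: measurable_good_graph.
have : (\sum_(0 <= i < n) rho (code_set i))%E @[n --> \oo] --> rho (\bigcup_N code_set N).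
  exact: (@measure_semi_sigma_additive _ _ _ rho code_set measurable_code_set trivIset_code mU).
rewrite bigcup_code [X in _ --> X]rhoW.
under eq_fun do under eq_bigr do rewrite -code_probE.
under eq_fun do rewrite sumEFin big_mkord.
by move=> /fine_cvgP[].
Qed.

Variables (f : RG -> R) (phi : nat -> R) (C : R).
Hypothesis fphi : forall N g, code_set N g -> f g = phi N.
Hypothesis phi2 : forall M, \sum_(N < M) phi N ^+ 2 * code_prob N <= C.

Lemma code_measurable : measurable_fun good_graph f.
Proof.
move=> _ Y mY; rewrite (_ : _ `&` _ =
    \bigcup_N (if `[< Y (phi N) >] then code_set N else set0)).
  by apply: bigcup_measurable => N _; case: ifP => // _; exact: measurable_code_set.
rewrite -bigcup_code; apply/seteqP; split=> g /=.
  by move=> [[N _ gN] Yg]; exists N => //; rewrite asboolT // -(fphi gN).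
move=> [N _]; case: asboolP => // YN gN; split; first by exists N.
by rewrite /preimage /= (fphi gN).
Qed.

Lemma sum_abs_code M : \sum_(N < M) `|phi N| * code_prob N <= C + 1.
Proof.
apply: (@le_trans _ _ (\sum_(N < M) (phi N ^+ 2 * code_prob N + code_prob N))).
  apply: ler_sum => N _; rewrite -{3}[code_prob N]mul1r -mulrDl.
  rewrite ler_wpM2r ?code_prob_ge0 //.
  by have := @young_weight R (phi N) 1 ltr01; rewrite mul1r invr1.
rewrite big_split /=; apply: lerD; first exact: phi2.
have nd : nondecreasing_seq (fun M : nat => \sum_(N < M) code_prob N).
  apply/nondecreasing_seqP => k; rewrite big_ord_recr /= lerDl; exact: code_prob_ge0.
apply: (@le_trans _ _ (limn (fun M : nat => \sum_(N < M) code_prob N))).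
  have cv : cvgn (fun M : nat => \sum_(N < M) code_prob N).
    by apply/cvg_ex; exists (1 : R); exact: sum_code_prob.
  exact: (nondecreasing_cvgn_le nd cv M).
by rewrite (cvg_lim (@Rhausdorff R) sum_code_prob).
Qed.

Lemma integral_code_set (h : RG -> R) (psi : nat -> R) N :
  (forall N g, code_set N g -> h g = psi N) ->
  (\int[rho]_(g in code_set N) (h g)%:E = (psi N * code_prob N)%:E)%E.
Proof.
move=> hpsi; rewrite EFinM code_probE -(integral_cst rho (measurable_code_set N)).
by apply: eq_integral => g; rewrite inE => gN; rewrite (hpsi _ _ gN).
Qed.

Lemma code_integrable : rho.-integrable good_graph (EFin \o f).
Proof.
apply/integrableP; split; first by apply/measurable_EFinP; exact: code_measurable.
rewrite -bigcup_code ge0_integral_bigcup; last 4 first.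
- exact: measurable_code_set.
- rewrite bigcup_code; apply: measurableT_comp => //.
  by apply/measurable_EFinP; exact: code_measurable.
- by [].
- exact: trivIset_code.
apply: (@le_lt_trans _ _ (C + 1)%:E); last exact: ltry.
apply: lime_le; first by apply: is_cvg_nneseries => N _ _; exact: integral_ge0.
apply: nearW => M; under eq_bigr do rewrite (integral_code_set (h := fun g => `|f g|)
  (psi := fun N => `|phi N|)) => [|? ? /fphi ->//].
by rewrite sumEFin big_mkord lee_fin; exact: sum_abs_code.
Qed.

Lemma cvg_sum_code : \sum_(N < M) phi N * code_prob N @[M --> \oo]
  --> fine (\int[rho]_(g in good_graph) (f g)%:E)%E.
Proof.
have cS : cvgn (fun M : nat => \sum_(N < M) phi N * code_prob N).
  have : cvgn (series (fun N => phi N * code_prob N)).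
    apply: normed_cvg; apply: nondecreasing_is_cvgn.
      by apply/nondecreasing_seqP => k; rewrite /= seriesSr lerDl.
    exists (C + 1) => _ [M _ <-]; rewrite /= /series /= big_mkord.
    apply: le_trans (sum_abs_code M); apply: ler_sum => N _.
    by rewrite normrM (ger0_norm (code_prob_ge0 N)).
  by rewrite /series /=; under eq_fun do rewrite big_mkord.
rewrite -bigcup_code integral_bigcup; last 3 first.
- exact: trivIset_code.
- exact: measurable_code_set.
- by rewrite bigcup_code; exact: code_integrable.
under eq_eseriesr do rewrite (integral_code_set _ fphi).
rewrite (_ : fine _ = limn (fun M : nat => \sum_(N < M) phi N * code_prob N)) //.
under eq_fun do rewrite sumEFin big_mkord.
rewrite -[RHS]/(fine (limn (fun M : nat => \sum_(N < M) phi N * code_prob N))%:E).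
by congr fine; exact: (EFin_lim cS).
Qed.
End CodeIntegral.

Section LocalLimit.
Variables (R : realType) (r : nat).

Lemma fcode_exists (G : fmgraph) (x : 'I_(nv G)) : exists N, ball_code (@fmult G) x r N.
Proof. by apply: ball_code_exists; exact: finite_finset. Qed.

Definition fcode (G : fmgraph) (x : 'I_(nv G)) : nat := projT1 (cid (fcode_exists x)).

Lemma fcodeP (G : fmgraph) (x : 'I_(nv G)) : ball_code (@fmult G) x r (fcode x).
Proof. exact: projT2 (cid (fcode_exists x)). Qed.

Lemma fcodeE (G : fmgraph) (x : 'I_(nv G)) N : (fcode x == N) = `[< ball_code (@fmult G) x r N >].
Proof.
apply/eqP/asboolP => [<-|h]; first exact: fcodeP.
exact: ball_code_uniq (fcodeP x) h.
Qed.

Definition freq (G : fmgraph) (N : nat) : R :=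
  (\sum_(x < nv G) (fcode x == N)%:R) / (nv G)%:R.

Lemma freq_ge0 G N : 0 <= freq G N.
Proof. by rewrite /freq divr_ge0 // sumr_ge0. Qed.

Definition code_bound (G : fmgraph) : nat := (\max_(x < nv G) fcode x).+1.

Lemma fcode_lt (G : fmgraph) (x : 'I_(nv G)) : (fcode x < code_bound G)%N.
Proof. by rewrite ltnS; exact: leq_bigmax. Qed.

Lemma freq_code_bound G N : (code_bound G <= N)%N -> freq G N = 0.
Proof.
move=> BN; rewrite /freq big1 ?mul0r // => x _.
by rewrite ltn_eqF // (leq_trans (fcode_lt x)).
Qed.

Lemma avg_code (G : fmgraph) (psi : nat -> R) :
  \sum_(N < code_bound G) psi N * freq G N = (\sum_(x < nv G) psi (fcode x)) / (nv G)%:R.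
Proof.
under eq_bigr do rewrite /freq mulrA mulr_sumr.
rewrite -mulr_suml exchange_big /=; congr (_ / _); apply: eq_bigr => x _.
rewrite (bigD1 (Ordinal (fcode_lt x))) //= eqxx mulr1 big1 ?addr0 // => N Nx.
by rewrite (_ : (fcode x == N) = false) ?mulr0 //; apply: contraNF Nx => /eqP xN; apply/eqP/val_inj.
Qed.

Variables (G : nat -> fmgraph) (rho : probability RG R).
Hypotheses (r0 : (0 < r)%N) (G0 : forall n, (0 < nv (G n))%N).
Hypotheses (rhoW : on_rooted_infinite rho) (Glim : rw_limit G rho).

(** By the dichotomy, either [N] stands for a whole isomorphism class and [freq] is a value of [pU],
    or [N] is never selected and both sides are 0. *)
Lemma freq_cvg N : freq (G n) N @[n --> \oo] --> code_prob rho r N.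
Proof.
have freqE n : freq (G n) N
    = (#|[pred x : 'I_(nv (G n)) | `[< ball_code (@fmult (G n)) x r N >]]|)%:R / (nv (G n))%:R.
  rewrite /freq; congr (_ / _); rewrite -sum1_card natr_sum [RHS]big_mkcond /=.
  by apply: eq_bigr => x _; rewrite fcodeE inE; case: asbool.
have codeE : code_prob rho r N = fine (rho [set g : RG | ball_code g 0%N r N]).
  by rewrite /code_prob /code_set rho_good //; exact: measurable_ball_code.
have zero : (forall (V : Type) (m : V -> V -> nat) (o : V), ~ ball_code m o r N) ->
    freq (G n) N @[n --> \oo] --> code_prob rho r N.
  move=> nb; rewrite codeE (_ : [set g : RG | _] = set0); last first.
    by apply/seteqP; split=> // g hg; case: (nb _ _ _ hg).
  have f0 n : freq (G n) N = 0.
    rewrite freqE eq_card0 ?mul0r // => x.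
    by rewrite inE; apply: asboolF; exact: nb.
  by rewrite measure0 /=; under eq_fun do rewrite f0; exact: cvg_cst.
case: (ball_code_dichotomy r N) => [hb|]; last exact: zero.
case NH: (unpickle N : option rooted_code) => [H|]; last first.
  by apply: zero => V m o [[H]]; rewrite NH.
have isoE (V : Type) (m : V -> V -> nat) (o : V) :
    ball_code m o r N <-> ball_iso m o r (@code_mult H) (code_root H).
  rewrite -hb; split=> [[H']|]; first by rewrite NH => -[<-].
  by exists H.
rewrite codeE (_ : [set g : RG | _] =
  [set g : RG | ball_iso g 0%N r (@code_mult H) (code_root H)]); last first.
  by apply/seteqP; split=> g /isoE.
have := @Glim r r0 _ (@code_mult H) (code_root H).
rewrite /prho; apply: cvg_trans; apply: near_eq_cvg; apply: nearW => n.
rewrite freqE /pU card_set_bool; congr (_%:R / _); apply: eq_card => x.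
by rewrite !inE; apply: asbool_equiv_eq; rewrite isoE.
Qed.

Variables (F : forall n, 'I_(nv (G n)) -> R) (f : RG -> R) (phi : rooted_code -> R) (C : R).
Hypothesis Fphi : forall n x (H : rooted_code),
  ball_iso (@fmult (G n)) x r (@code_mult H) (code_root H) -> @F n x = phi H.
Hypothesis fphi : forall g (H : rooted_code),
  ball_iso g 0%N r (@code_mult H) (code_root H) -> f g = phi H.
Hypothesis F2 : forall n, (\sum_(x < nv (G n)) @F n x ^+ 2) / (nv (G n))%:R <= C.

Let phiN N := if unpickle N is Some H then phi H else 0.

Let FphiN n (x : 'I_(nv (G n))) : @F n x = phiN (fcode x).
Proof. by have [[H NH hH] _] := fcodeP x; rewrite /phiN NH; exact: Fphi. Qed.

Let fphiN N g : code_set r N g -> f g = phiN N.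
Proof. by move=> [_ [[H NH hH] _]]; rewrite /phiN NH; exact: fphi. Qed.

Let sum_phi2 n M : \sum_(N < M) phiN N ^+ 2 * freq (G n) N <= C.
Proof.
apply: le_trans (F2 n); under [X in _ <= X / _]eq_bigr do rewrite FphiN.
rewrite -(avg_code (G n) (fun N => phiN N ^+ 2)).
have t0 N : 0 <= phiN N ^+ 2 * freq (G n) N by rewrite mulr_ge0 ?sqr_ge0 ?freq_ge0.
rewrite -(big_mkord xpredT (fun N => phiN N ^+ 2 * freq (G n) N)).
rewrite -(big_mkord xpredT (fun N => phiN N ^+ 2 * freq (G n) N)).
have [MB|/ltnW BM] := leqP M (code_bound (G n)).
  by rewrite [leRHS](@big_cat_nat _ _ _ M) //= lerDl sumr_ge0.
rewrite (@big_cat_nat _ _ _ (code_bound (G n))) //= [X in _ + X]big_nat_cond.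
rewrite [X in _ + X]big1 ?addr0 // => N /andP[/andP[/freq_code_bound -> _] _].
by rewrite mulr0.
Qed.

(** Fatou's argument: each finite partial sum inherits the bound from the graphs [G n]. *)
Let phi2 M : \sum_(N < M) phiN N ^+ 2 * code_prob rho r N <= C.
Proof.
have cv : \sum_(N < M) phiN N ^+ 2 * freq (G n) N @[n --> \oo]
    --> \sum_(N < M) phiN N ^+ 2 * code_prob rho r N.
  by apply: cvg_sumr => N _; apply: cvgMr; exact: freq_cvg.
rewrite -(cvg_lim (@Rhausdorff R) cv).
apply: limr_le; first by apply/cvg_ex; eexists; exact: cv.
by apply: nearW => n; exact: sum_phi2.
Qed.

Lemma local_integrable : rho.-integrable good_graph (EFin \o f).
Proof. exact: code_integrable fphiN phi2. Qed.

Lemma local_limit : (\sum_(x < nv (G n)) @F n x) / (nv (G n))%:R @[n --> \oo]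
  --> fine (\int[rho]_(g in good_graph) (f g)%:E)%E.
Proof.
have := @weighted_cvg R (fun n => freq (G n)) (code_prob rho r) phiN
  (fun n => code_bound (G n)) C _ (fun n => freq_ge0 (G n)) freq_cvg
  (fun n => @freq_code_bound (G n)) _ (fun n => sum_phi2 n _)
  (sum_code_prob r rhoW) (cvg_sum_code rhoW fphiN phi2).
under eq_fun => n do (rewrite avg_code; under eq_bigr do rewrite -FphiN).
apply=> n; have := avg_code (G n) (fun=> 1).
under eq_bigr do rewrite mul1r.
by move=> ->; rewrite sumr_const card_ord -[1 *+ _]/((nv (G n))%:R) divff // pnatr_eq0 -lt0n.
Qed.
End LocalLimit.

(** * Balls with few vertices, and growth of the graphs *)

Section SmallBalls.

Definition ball_covered (V : Type) (m : V -> V -> nat) (o : V) (r M : nat) : Prop :=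
  exists f : 'I_M -> V, forall v, within m r o v -> exists i, f i = v.

Lemma ball_covered_iso (V : Type) (m : V -> V -> nat) (o : V) r M k
    (mH : 'I_k -> 'I_k -> nat) (rH : 'I_k) :
  ball_iso m o r mH rH -> ball_covered m o r M <-> (k <= M)%N.
Proof.
move=> [f [fI fr fB fm]]; split=> [[h hP]|kM].
  have gE (i : 'I_k) : exists j : 'I_M, h j = f i by apply: hP; apply/fB; exists i.
  have [g gP] := choice gE.
  have gI : injective g by move=> i j gij; apply: fI; rewrite -!gP gij.
  by have := leq_card g gI; rewrite !card_ord.
exists (fun i => if insub (val i) is Some j then f j else o) => v /fB[i <-].
exists (widen_ord kM i); rewrite /= insubT //= => ik.
by congr f; apply: val_inj.
Qed.

Lemma asbool_ball_covered (V : Type) (m : V -> V -> nat) (o : V) r M k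
    (mH : 'I_k -> 'I_k -> nat) (rH : 'I_k) :
  ball_iso m o r mH rH -> `[< ball_covered m o r M >] = (k <= M)%N.
Proof. by move=> hH; apply/asboolP/idP => /(ball_covered_iso M hH). Qed.

Lemma ball_covered_fin n (m : 'I_n -> 'I_n -> nat) (x : 'I_n) r M :
  (n <= M)%N -> ball_covered m x r M.
Proof.
move=> nM; exists (fun i => if insub (val i) is Some j then j else x) => v _.
exists (widen_ord nM v); rewrite /= insubT //= => vn.
exact: val_inj.
Qed.

(** An infinite component has a vertex at every distance, since one empty sphere would confine it to
    a finite ball. The radii 1 to [M + 1] thus supply [M + 1] distinct vertices. *)
Lemma good_ball_not_covered (g : RG) M : good_graph g -> ~ ball_covered g 0%N M.+1 M.
Proof.
move=> [gv ginf] [h hP].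
have vE s : exists v, within g s.+1 0%N v /\ ~ within g s 0%N v.
  apply: contrapT => nv; apply: ginf.
  have sub v : within g s.+1 0%N v -> within g s 0%N v.
    by move=> hv; apply: contrapT => nhv; apply: nv; exists v.
  apply: (@sub_finite_set _ _ [set v | within g s 0%N v]); last exact: finite_ball.
  move=> v [t]; have [ts|/ltnW st] := leqP t s; first exact: within_leq ts.
  elim: t st v => [|t IH]; first by rewrite leqn0 => /eqP-> v.
  rewrite leq_eqVlt => /orP[/eqP<- v //|]; rewrite ltnS => st v /= [|[z [tz gz]]].
    exact: IH.
  by apply: sub; right; exists z; split=> //; exact: IH.
have [v vP] := choice vE.
have cE (s : 'I_M.+1) : exists j : 'I_M, h j = v s.
  by apply: hP; apply: within_leq (proj1 (vP s)); rewrite ltnS -ltnS.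
have [c cP] := choice cE.
have vI s t : v s = v t -> (s <= t)%N.
  move=> st; rewrite leqNgt; apply/negP => ts; have [_] := vP s; apply.
  by rewrite st; apply: within_leq (proj1 (vP t)).
have cI : injective c.
  move=> s t cst; have st : v s = v t by rewrite -!cP cst.
  by apply/val_inj/eqP; rewrite /= eqn_leq !vI.
by have := leq_card c cI; rewrite !card_ord ltnn.
Qed.
End SmallBalls.

(** Write [ln x] as twice the logarithm of the square root of [x], which is below that root. *)
Lemma ln_nat_sqr_le (R : realType) (n : nat) : (ln n%:R : R) ^+ 2 <= 4 * n%:R.
Proof.
case: n => [|n]; first by rewrite ln0 // expr0n mulr0.
set x : R := n.+1%:R; have x0 : 0 < x by rewrite ltr0n.
have s0 : 0 < Num.sqrt x by rewrite sqrtr_gt0.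
have xE : Num.sqrt x ^+ 2 = x by rewrite sqr_sqrtr // ltW.
have l0 : 0 <= ln x by rewrite ln_ge0 // ler1n.
have -> : 4 * x = (2 * Num.sqrt x) ^+ 2 by rewrite exprMn xE -natrX.
rewrite lerXn2r ?nnegrE ?mulr_ge0 ?(ltW s0) //.
have -> : ln x = 2 * ln (Num.sqrt x) by rewrite -[in LHS]xE lnXn // mulr_natl.
by rewrite ler_wpM2l // ltW // ln_sublinear.
Qed.

(** Stated for arbitrary multiplicities, so a vertex may have degree 0; its row then vanishes and
    row sums are only at most 1. *)
Lemma walk_mx_expr_bounds (R : realType) n (m : 'I_n -> 'I_n -> nat) k (x y : 'I_n) :
  0 <= (walk_mx R m ^+ k) x y <= 1.
Proof.
have w0 a b : 0 <= walk_mx R m a b by rewrite mxE divr_ge0.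
suff [h0 h1] : (forall a b, 0 <= (walk_mx R m ^+ k) a b) /\
    forall a, \sum_b (walk_mx R m ^+ k) a b <= 1.
  rewrite h0 /=; apply: le_trans (h1 x); rewrite (bigD1 y) //= lerDl.
  exact: sumr_ge0.
elim: k => [|k [h0 h1]].
  split=> [a b|a]; first by rewrite expr0 mxE.
  rewrite (bigD1 a) //= expr0 mxE eqxx big1 ?addr0 // => b ba.
  by rewrite mxE eq_sym (negPf ba).
split=> [a b|a].
  by rewrite exprS -mulmxE mxE; apply: sumr_ge0 => c _; rewrite mulr_ge0.
apply: le_trans (h1 a); under eq_bigr do rewrite exprSr -mulmxE mxE.
rewrite exchange_big /=; apply: ler_sum => b _; rewrite -mulr_sumr ler_piMr //.
under eq_bigr do rewrite mxE.
rewrite -mulr_suml -ndegE; have [->|d0] := eqVneq (ndeg R m b) 0; first by rewrite mul0r.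
by rewrite divff.
Qed.

Lemma mean_le1 (R : numFieldType) n (a : 'I_n -> R) :
  (forall x, a x <= 1) -> (\sum_x a x) / n%:R <= 1.
Proof.
move=> a1; case: n a a1 => [|n] a a1; first by rewrite invr0 mulr0.
rewrite ler_pdivrMr ?ltr0n // mul1r.
by apply: le_trans (ler_sum _ (fun x _ => a1 x)) _; rewrite sumr_const card_ord.
Qed.

Section DeterministicLimit.
Variables (R : realType) (G : nat -> fmgraph) (rho : probability RG R) (C : R).
Hypotheses (Gok : forall n, loopless (G n) /\ fconnected (G n)).
Hypotheses (Gavg : forall n, avg_deg (G n) <= C).
Hypotheses (rhoW : on_rooted_infinite rho) (Glim : rw_limit G rho).

Let G0 n : (0 < nv (G n))%N. Proof. by have [_ []] := Gok n. Qed.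
Let nv0 n : 0 < (nv (G n))%:R :> R. Proof. by rewrite ltr0n. Qed.

Definition avg n (F : 'I_(nv (G n)) -> R) : R := (\sum_x F x) / (nv (G n))%:R.

(** Having at most [M] vertices in the ball of radius [M + 1] is a local event, null under [rho],
    yet of frequency 1 in a graph with at most [M] vertices. *)
Lemma nv_cvg M : \forall n \near \oo, (M < nv (G n))%N.
Proof.
pose F n (x : 'I_(nv (G n))) : R := (`[< ball_covered (@fmult (G n)) x M.+1 M >])%:R.
pose f (g : RG) : R := (`[< ball_covered g 0%N M.+1 M >])%:R.
have := @local_limit R M.+1 G rho (ltn0Sn _) G0 rhoW Glim F f
  (fun H : rooted_code => (tag H <= M)%N%:R) 1.
have -> : (\int[rho]_(g in good_graph) (f g)%:E)%E = 0%E.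
  rewrite (eq_integral (cst 0%E)) ?integral0 // => g; rewrite inE => gW.
  by rewrite /f asboolF //; exact: good_ball_not_covered.
move=> lim; have {}lim : avg (F n) @[n --> \oo] --> (0 : R).
  apply: lim.
  - by move=> n x H hH; rewrite /F (asbool_ball_covered _ hH).
  - by move=> g H hH; rewrite /f (asbool_ball_covered _ hH).
  - by move=> n; apply: mean_le1 => x; rewrite /F; case: asbool; rewrite ?expr1n ?expr0n.
move/cvgrPdist_lt: lim => /(_ 1 ltr01); apply: filterS => n.
rewrite sub0r normrN ltnNge => h; apply/negP => nM; move: h.
rewrite /avg (eq_bigr (fun=> 1)) => [|x _].
  by rewrite sumr_const card_ord -[1 *+ _]/((nv (G n))%:R) divff ?normr1 ?ltxx // gt_eqF.
by rewrite /F asboolT //; exact: ball_covered_fin.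
Qed.

Let avg_vol n : @nvol R (nv (G n)) (@fmult (G n)) / (nv (G n))%:R <= C.
Proof. by rewrite nvolE; [exact: Gavg | case: (Gok n)]. Qed.

Lemma ln_deg_cvg : rho.-integrable good_graph (EFin \o (fun g : RG => ln (deg g 0%N))) /\
  avg (fun x : 'I_(nv (G n)) => ln (ndeg R (@fmult (G n)) x)) @[n --> \oo] -->
  fine (\int[rho]_(g in good_graph) (ln (deg g 0%N))%:E)%E.
Proof.
pose F n (x : 'I_(nv (G n))) : R := ln (ndeg R (@fmult (G n)) x).
pose f (g : RG) : R := ln (deg g 0%N).
pose phi (H : rooted_code) : R := ln (ndeg R (@code_mult H) (code_root H)).
have h1 n x (H : rooted_code) : ball_iso (@fmult (G n)) x 1 (@code_mult H) (code_root H) ->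
  F n x = phi H by move=> hH; rewrite /F (ndeg_local R _ hH).
have h2 g (H : rooted_code) : ball_iso g 0%N 1 (@code_mult H) (code_root H) ->
  f g = phi H by move=> hH; rewrite /f (deg_local R _ hH).
have h3 n : (\sum_(x < nv (G n)) F n x ^+ 2) / (nv (G n))%:R <= 4 * C.
  apply: le_trans (_ : 4 * (nvol R (@fmult (G n)) / (nv (G n))%:R) <= _); last first.
    by rewrite ler_wpM2l.
  rewrite mulrA ler_wpM2r ?invr_ge0 // /nvol mulr_sumr; apply: ler_sum => x _.
  exact: ln_nat_sqr_le.
have h4 := local_integrable (r := 1) isT rhoW Glim h1 h2 h3.
split => //.
exact: (local_limit (r := 1) isT G0 rhoW Glim h1 h2 h3).
Qed.

Lemma ret_prob_cvg k : rho.-integrable good_graph (EFin \o (fun g : RG => ret_prob g k 0%N)) /\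
  avg (fun x : 'I_(nv (G n)) => (walk_mx R (@fmult (G n)) ^+ k) x x) @[n --> \oo] -->
  fine (\int[rho]_(g in good_graph) (ret_prob g k 0%N)%:E)%E.
Proof.
pose F n (x : 'I_(nv (G n))) : R := (walk_mx R (@fmult (G n)) ^+ k) x x.
pose f (g : RG) : R := ret_prob g k 0%N.
pose phi (H : rooted_code) : R := (walk_mx R (@code_mult H) ^+ k) (code_root H) (code_root H).
(* Radius [k.+1] stays positive when [k] is 0, as the weak limit requires. *)
have h1 n x (H : rooted_code) :
    ball_iso (@fmult (G n)) x k.+1 (@code_mult H) (code_root H) -> F n x = phi H.
  by move=> hH; rewrite /F (walk_mx_local R _ hH).
have h2 g (H : rooted_code) : ball_iso g 0%N k.+1 (@code_mult H) (code_root H) ->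
  f g = phi H by move=> hH; rewrite /f (ret_prob_local R _ hH).
have h3 n : (\sum_(x < nv (G n)) F n x ^+ 2) / (nv (G n))%:R <= 1.
  apply: mean_le1 => x; have /andP[F0 F1] := @walk_mx_expr_bounds R _ (@fmult (G n)) k x x.
  by rewrite /F expr_le1.
split; first exact: (local_integrable (r := k.+1) isT rhoW Glim h1 h2 h3).
exact: (local_limit (r := k.+1) isT G0 rhoW Glim h1 h2 h3).
Qed.
End DeterministicLimit.

(** * Convergence to the tree entropy *)

(** The sign is read off the ball, where the limits defining [walk] become an entry of a matrix
    power. *)
Lemma ret_prob_ge0 (R : realType) (g : rgraph) k : valid_graph g -> 0 <= (ret_prob g k 0%N : R).
Proof.
move=> gv; have [N [[H _ hH] _]] := ball_code_exists (finite_ball k gv).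
rewrite (ret_prob_local R (leqnn k) hH).
by case/andP: (walk_mx_expr_bounds R (@code_mult H) k (code_root H) (code_root H)).
Qed.

Section EntropyLimit.
Variables (R : realType) (G : nat -> fmgraph) (rho : probability RG R) (C : R).
Hypotheses (Gok : forall n, loopless (G n) /\ fconnected (G n)).
Hypotheses (Gavg : forall n, avg_deg (G n) <= C).
Hypotheses (rhoW : on_rooted_infinite rho) (Glim : rw_limit G rho).

Let X n : R := ln (tau (G n))%:R / (nv (G n))%:R.
Let ell : R := fine (\int[rho]_(g in good_graph) (ln (deg g 0%N))%:E)%E.
Let q k : R := fine (\int[rho]_(g in good_graph) (ret_prob g k 0%N)%:E)%E.
Let S K : R := \sum_(1 <= k < K.+1) q k / k%:R.
Let err K : R := K.+1%:R^-1 + 6 * (4 * C + 1) / Num.sqrt K%:R.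

Let C0 : 0 <= C.
Proof. by apply: le_trans (Gavg 0); rewrite /avg_deg divr_ge0. Qed.

Let Avg n K : R := avg (fun x : 'I_(nv (G n)) => ln (ndeg R (@fmult (G n)) x))
  - \sum_(1 <= k < K.+1) avg (fun x : 'I_(nv (G n)) => (walk_mx R (@fmult (G n)) ^+ k) x x) / k%:R.

Let Avg_cvg K : Avg n K @[n --> \oo] --> ell - S K.
Proof.
apply: cvgB; first by have [] := ln_deg_cvg Gok Gavg rhoW Glim.
apply: cvg_sumr => k _; apply: cvgMl.
by have [] := ret_prob_cvg Gok rhoW Glim k.
Qed.

(** The parameter [del] absorbs [ln vol] through [ln vol <= del * (ln vol) ^ 2 + del^-1]: divided by
    the number of vertices, the first part is of order [del * C] and the second vanishes as the
    graphs grow. *)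
Let estimate n K del : (4 <= K)%N -> (1 < nv (G n))%N -> 0 < del -> 0 <= X n /\
  `|X n - Avg n K| <= 4 * del * C + (del^-1 + K%:R) / (nv (G n))%:R + err K.
Proof.
move=> K4 n1 del0; have [Gl Gc] := Gok n.
have nv0 : 0 < (nv (G n))%:R :> R by rewrite ltr0n ltnW.
have nv1 : 1 <= (nv (G n))%:R :> R by rewrite ler1n ltnW.
have [tau0 est] := ln_tau_estimate R Gl Gc n1 K4.
split; first by rewrite /X divr_ge0 // ln_ge0 // ler1n.
set vol := nvol R _ in est.
have volE : vol = (2 * ne (G n))%:R by exact: nvolE.
have volC : vol / (nv (G n))%:R <= C by rewrite volE; exact: Gavg.
have vol0 : 0 <= vol by rewrite volE.
have lnv : ln vol <= del * (4 * vol) + del^-1.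
  apply: le_trans (ler_norm _) _; apply: le_trans (young_weight (ln vol) del0) _.
  by rewrite lerD2r ler_wpM2l ?(ltW del0) // volE ln_nat_sqr_le.
have sK : 0 < Num.sqrt K%:R :> R by rewrite sqrtr_gt0 ltr0n; lia.
have -> : X n - Avg n K = (ln (tau (G n))%:R - \sum_v (ln (ndeg R (@fmult (G n)) v)
    - \sum_(1 <= k < K.+1) (walk_mx R (@fmult (G n)) ^+ k) v v / k%:R)) / (nv (G n))%:R.
  rewrite mulrBl; congr (_ - _); rewrite sumrB mulrBl; congr (_ - _).
  rewrite exchange_big /= mulr_suml; apply: eq_bigr => k _.
  by rewrite /avg -mulr_suml mulrAC.
rewrite normrM (gtr0_norm (_ : 0 < (nv (G n))%:R^-1)) ?invr_gt0 // ler_pdivrMr //.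
apply: le_trans est _.
have -> : (4 * del * C + (del^-1 + K%:R) / (nv (G n))%:R + err K) * (nv (G n))%:R
  = 4 * del * (C * (nv (G n))%:R) + (del^-1 + K%:R) + (nv (G n))%:R / K.+1%:R
    + 6 * (4 * (C * (nv (G n))%:R) + (nv (G n))%:R) / Num.sqrt K%:R.
  by rewrite /err; field; rewrite !gt_eqF //= ?sK // addrC natr1 pnatr_eq0.
have volC' : vol <= C * (nv (G n))%:R by rewrite -ler_pdivrMr.
apply: lerD; last by rewrite ler_pM2r ?invr_gt0 //; lra.
rewrite lerD2r addrA lerD2r; apply: le_trans lnv _; rewrite lerD2r.
by rewrite mulrA [del * 4]mulrC; apply: ler_wpM2l => //; rewrite mulr_ge0 // ltW.
Qed.

Lemma tau_near K eta : (4 <= K)%N -> 0 < eta ->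
  \forall n \near \oo, 0 <= X n /\ `|X n - (ell - S K)| <= err K + eta.
Proof.
move=> K4 eta0; pose del := eta / (16 * (C + 1)).
have C1 : 0 < C + 1 by have := C0; lra.
have del0 : 0 < del by rewrite divr_gt0 ?mulr_gt0.
have delC : 4 * del * C <= eta / 4.
  rewrite /del; have -> : 4 * (eta / (16 * (C + 1))) * C = eta / 4 * (C / (C + 1)).
    by field; rewrite gt_eqF.
  by rewrite ler_piMr ?divr_ge0 ?(ltW eta0) // ler_pdivrMr // mul1r; lra.
pose M := Num.bound ((del^-1 + K%:R) / (eta / 4)).
have MP : (del^-1 + K%:R) / (eta / 4) < M%:R.
  by apply: archi_boundP; rewrite divr_ge0 ?addr_ge0 ?invr_ge0 ?(ltW del0) // divr_ge0 // ltW.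
have n1 := nv_cvg Gok rhoW Glim 1.
have nM := nv_cvg Gok rhoW Glim M.
have nA0 : Avg n K @[n --> \oo] --> ell - S K by exact: Avg_cvg.
move/cvgrPdist_le: nA0 => /(_ (eta / 2)); rewrite divr_gt0 // => /(_ isT) nA.
near=> n.
have h1 : (1 < nv (G n))%N by near: n; exact: n1.
have hM : (M < nv (G n))%N by near: n; exact: nM.
have hA : `|ell - S K - Avg n K| <= eta / 2 by near: n; exact: nA.
have [X0 est] := estimate K4 h1 del0; split=> //.
have nv0 : 0 < (nv (G n))%:R :> R by rewrite ltr0n ltnW.
have small : (del^-1 + K%:R) / (nv (G n))%:R <= eta / 4.
  rewrite ler_pdivrMr // mulrC -ler_pdivrMr ?divr_gt0 //.
  by apply: le_trans (ltW MP) _; rewrite ler_nat ltnW.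
rewrite distrC in hA; rewrite -(subrKA (Avg n K)); apply: le_trans (ler_normD _ _) _.
by move: est hA small delC; lra.
Unshelve. all: by end_near. Qed.

Let q_ge0 k : 0 <= q k.
Proof.
by apply: fine_ge0; apply: integral_ge0 => g [gv _]; rewrite lee_fin ret_prob_ge0.
Qed.

Let S_nd : nondecreasing_seq S.
Proof.
by apply/nondecreasing_seqP => K; rewrite /S [leRHS]big_nat_recr //= lerDl divr_ge0.
Qed.

Let err_decr K : (4 <= K)%N -> err K <= err 4.
Proof.
move=> K4; rewrite /err; apply: lerD.
  by rewrite lef_pV2 ?posrE ?ltr0n // ler_nat.
rewrite ler_wpM2l //; first by have := C0; lra.
have sK : 0 < Num.sqrt K%:R :> R by rewrite sqrtr_gt0 ltr0n; lia.
have s4 : 0 < Num.sqrt 4%:R :> R by rewrite sqrtr_gt0 ltr0n.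
by rewrite lef_pV2 ?posrE //; apply: ler_wsqrtr; rewrite ler_nat.
Qed.

(** Since [X n >= 0], any [n] for which [X n] is within [err K + 1] of [ell - S K] bounds [S K] from
    above. Monotonicity of [S] reduces to [K >= 4]. *)
Let S_bounded K : S K <= ell + err 4 + 1.
Proof.
apply: (@le_trans _ _ (S (maxn K 4))); first by apply: S_nd; exact: leq_maxl.
have K4 : (4 <= maxn K 4)%N by exact: leq_maxr.
have [n _ /(_ n (leqnn n))[X0]] := tau_near K4 ltr01.
have := err_decr K4; rewrite ler_norml => e4 /andP[_ h]; lra.
Qed.

Definition entropy_sum : R := limn S.

Lemma entropy_sum_cvg : S K @[K --> \oo] --> entropy_sum.
Proof.
apply: (@nondecreasing_is_cvgn _ S S_nd).
by exists (ell + err 4 + 1) => _ [K _ <-]; exact: S_bounded.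
Qed.

Lemma err_cvg0 e : 0 < e -> \forall K \near \oo, err K <= e.
Proof.
move=> e0; pose c := 6 * (4 * C + 1).
have c0 : 0 < c by have := C0; rewrite /c; lra.
have e2 : 0 < e / 2 by rewrite divr_gt0.
near=> K.
have h1 : (e / 2)^-1 <= K%:R by near: K; exact: nbhs_infty_ger.
have h2 : (c / (e / 2)) ^+ 2 <= K%:R by near: K; exact: nbhs_infty_ger.
have K0 : 0 < K%:R :> R by apply: lt_le_trans h1; rewrite invr_gt0.
have sK : 0 < Num.sqrt K%:R :> R by rewrite sqrtr_gt0.
have e1 : K.+1%:R^-1 <= e / 2.
  rewrite -[e / 2]invrK lef_pV2 ?posrE ?invr_gt0 ?ltr0n //.
  by apply: le_trans h1 _; rewrite ler_nat.
have e3 : c / Num.sqrt K%:R <= e / 2.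
  rewrite ler_pdivrMr // mulrC -ler_pdivrMr //.
  rewrite -(@ler_pXn2r _ 2) ?nnegrE ?(ltW sK) //; last by rewrite divr_ge0 ?ltW.
  by rewrite sqr_sqrtr // ltW.
rewrite /err -/c; move: e1 e3; move: (c / _) (K.+1%:R^-1) => x y; lra.
Unshelve. all: by end_near. Qed.

(** [K] is fixed before [n] grows; this is legitimate because [err K] does not depend on [n]. *)
Lemma tau_cvg : X n @[n --> \oo] --> ell - entropy_sum.
Proof.
apply/cvgrPdist_le => e e0.
have e3 : 0 < e / 3 by rewrite divr_gt0.
have [K [K4 eK SK]] : exists K, [/\ (4 <= K)%N, err K <= e / 3 & `|entropy_sum - S K| <= e / 3].
  have c1 := err_cvg0 e3.
  have c2 : S K @[K --> \oo] --> entropy_sum by exact: entropy_sum_cvg.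
  move/cvgrPdist_le: c2 => /(_ _ e3) c2.
  have c3 : \forall K \near \oo, (4 <= K)%N by exact: nbhs_infty_ge.
  have [K _ /(_ K (leqnn K))[? []]] := filterI c3 (filterI c1 c2).
  by exists K.
have := tau_near K4 e3; apply: filterS => n [_ h].
move: eK SK h; move: (X n) (S K) (err K) entropy_sum ell => x s t l L.
by rewrite !ler_norml => ? /andP[? ?] /andP[? ?]; apply/andP; split; lra.
Qed.

(** Monotone convergence exchanges sum and integral; finiteness of [entropy_sum] makes the series
    integrable, so the difference may be integrated termwise. *)
Lemma tree_entropyE : tree_entropy rho = (ell - entropy_sum)%:E.
Proof.
have mW := measurable_good_graph.
rewrite /tree_entropy (integral_full mW (rho_notgood rhoW)).
pose u k (g : RG) : \bar R := ((ret_prob g k 0%N : R) / k%:R)%:E.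
have iu k : rho.-integrable good_graph (EFin \o (fun g : RG => ret_prob g k 0%N : R)).
  by have [] := ret_prob_cvg Gok rhoW Glim k.
have u0 k g : good_graph g -> (0 <= u k g)%E.
  by move=> [gv _]; rewrite lee_fin divr_ge0 // ret_prob_ge0.
have mu k : measurable_fun good_graph (u k).
  have /measurable_int/measurable_EFinP m := iu k.
  by apply/measurable_EFinP; apply: measurable_funM.
have Iu k : (\int[rho]_(g in good_graph) u k g = (q k / k%:R)%:E)%E.
  rewrite /u; under eq_integral do rewrite EFinM.
  rewrite integralZr //; last exact: iu.
  by rewrite EFinM fineK // integrable_fin_num //; exact: iu.
pose U (g : RG) : \bar R := (\sum_(k <oo) u k g)%E.
(* The term of index 0 is 0, because division by 0 yields 0. *)
have UE g : (\sum_(1 <= k <oo) u k g = U g)%E.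
  congr (limn _); apply/funext => -[|n]; first by rewrite !big_geq.
  have u00 : u 0%N g = 0%E by rewrite /u mulr0n invr0 mulr0.
  by rewrite [RHS]big_ltn // u00 add0e.
have IU : (\int[rho]_(g in good_graph) U g = entropy_sum%:E)%E.
  rewrite integral_nneseries //.
  under eq_eseriesr do rewrite Iu.
  apply: cvg_lim => //.
  rewrite -(cvg_shiftS (fun n => (\sum_(0 <= k < n) (q k / k%:R)%:E)%E)).
  have -> : (fun n => (\sum_(0 <= k < n.+1) (q k / k%:R)%:E)%E) = (fun n => (S n)%:E).
    by apply/funext => n; rewrite sumEFin big_ltn // mulr0n invr0 mulr0 add0r.
  by apply: cvg_EFin; [exact: nearW | exact: entropy_sum_cvg].
have mU : measurable_fun good_graph U by apply: ge0_emeasurable_sum => // k g gW _; exact: u0.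
have U0 g : good_graph g -> (0 <= U g)%E by move=> gW; apply: nneseries_ge0 => k _ _; exact: u0.
have iU : rho.-integrable good_graph U.
  apply/integrableP; split=> //.
  rewrite (eq_integral U) ?IU ?ltry // => g; rewrite inE => gW.
  by rewrite gee0_abs // U0.
have [il _] := ln_deg_cvg Gok Gavg rhoW Glim.
have -> : (\int[rho]_(g in good_graph) tree_entropy_integrand g)%E
    = (\int[rho]_(g in good_graph) ((EFin \o (fun g : RG => ln (deg g 0%N))) \- U) g)%E.
  by apply: eq_integral => g _; rewrite /tree_entropy_integrand UE.
rewrite integralB // IU EFinB; congr (_ - _)%E.
by rewrite /ell fineK // integrable_fin_num.
Qed.

Lemma tree_entropy_limit :
  (ln (tau (G n))%:R / (nv (G n))%:R)%:E @[n --> \oo] --> tree_entropy rho.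
Proof.
rewrite tree_entropyE; apply: cvg_EFin; last exact: tau_cvg.
exact: nearW.
Qed.
End EntropyLimit.

(** * Random graphs *)

Section Finitary.
Variables (R : realType) (rho : probability RG R).
Hypothesis rhoW : on_rooted_infinite rho.

(** One natural number enumerates all pairs of a positive radius and a finite rooted graph; an index
    that decodes to nothing gives a test that always succeeds. *)
Definition test (t : nat) (g : fmgraph) : R :=
  if unpickle t is Some (r, H) then
    `|pU r.+1 (@code_mult H) (code_root H) g - prho rho r.+1 (@code_mult H) (code_root H)|
  else 0.

Lemma rw_limit_tests (G : nat -> fmgraph) :
  (forall n t, (t < n)%N -> test t (G n) <= n.+1%:R^-1) -> rw_limit G rho.
Proof.
move=> Gt [//|r] _ k mH rH.
pose H : rooted_code := Tagged (fun k => ({ffun 'I_k -> {ffun 'I_k -> nat}} * 'I_k)%type)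
  ([ffun i => [ffun j => mH i j]], rH).
have HE : @code_mult H = mH by do 2!apply/funext => ?; rewrite /code_mult /= !ffunE.
pose t := pickle (r, H).
have tE g : test t g = `|pU r.+1 mH rH g - prho rho r.+1 mH rH|.
  by rewrite /test pickleK -[in RHS]HE.
apply/cvgrPdist_le => e e0; near=> n.
rewrite distrC -tE; apply: le_trans (Gt n t _) _; first by near: n; exact: nbhs_infty_gt.
rewrite -[e]invrK lef_pV2 ?posrE ?invr_gt0 ?ltr0n //.
apply: (@le_trans _ _ n%:R); last by rewrite ler_nat.
by near: n; exact: nbhs_infty_ger.
Unshelve. all: by end_near. Qed.

(* If no finite set of tests sufficed, the counterexamples would form a sequence
   with random weak limit [rho], contradicting the deterministic case. *)
Lemma tau_finitary (C eps : R) : 0 < eps -> exists N : nat, forall g : fmgraph,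
  loopless g -> fconnected g -> avg_deg g <= C ->
  (forall t, (t < N)%N -> test t g <= N.+1%:R^-1) ->
  ~ (eps%:E < `|(ln (tau g)%:R / (nv g)%:R : R)%:E - tree_entropy rho|)%E.
Proof.
move=> e0; apply: contrapT => /forallNP bad.
have badE N : exists g : fmgraph, [/\ loopless g /\ fconnected g, avg_deg g <= C,
    (forall t, (t < N)%N -> test t g <= N.+1%:R^-1) &
    (eps%:E < `|(ln (tau g)%:R / (nv g)%:R : R)%:E - tree_entropy rho|)%E].
  apply: contrapT => ng; apply: (bad N) => g gl gc ga gt ge.
  by apply: ng; exists g.
have [G GP] := choice badE.
have Gok n : loopless (G n) /\ fconnected (G n) by have [] := GP n.
have Gavg n : avg_deg (G n) <= C by have [] := GP n.
have Glim : rw_limit G rho by apply: rw_limit_tests => n; have [] := GP n.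
have lim := tau_cvg Gok Gavg rhoW Glim.
move/cvgrPdist_le: lim => /(_ _ e0)[n _ /(_ n (leqnn n))].
have [_ _ _] := GP n; rewrite (tree_entropyE Gok Gavg rhoW Glim) -EFinB abse_EFin lte_fin.
by rewrite distrC ltNge => /negP.
Qed.
End Finitary.

Section RandomGraphs.
Variables (R : realType) (d : measure_display) (Omega : measurableType d).
Variables (P : probability Omega R) (G : Omega -> fmgraph).
Hypothesis mG : forall g : fmgraph, measurable [set w | G w = g].

Definition fmgraph_code := {a : nat & {b : nat & {ffun 'I_b -> 'I_a * 'I_a}}}.

Definition fmgraph_decode (c : fmgraph_code) : fmgraph := FGraph (tagged (tagged c)).

(** Finite multigraphs are countable in number, so measurability of single values extends to every
    property. *)
Lemma measurable_graph_event (p : fmgraph -> Prop) : measurable [set w | p (G w)].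
Proof.
rewrite (_ : [set w | _] = [set w | exists c : fmgraph_code,
    p (fmgraph_decode c) /\ G w = fmgraph_decode c]).
  apply: measurable_ex => c; apply: measurable_and; first exact: measurable_const.
  exact: mG.
apply/seteqP; split=> w /=; last by move=> [c [pc ->]].
move=> pw; case GE: (G w) => [a b e].
exists (Tagged (fun a => {b : nat & {ffun 'I_b -> 'I_a * 'I_a}})
  (Tagged (fun b => {ffun 'I_b -> 'I_a * 'I_a}) e)).
by rewrite /fmgraph_decode /= -GE.
Qed.

Definition pr (p : fmgraph -> Prop) : R := fine (P [set w | p (G w)]).

Lemma prE p : (pr p)%:E = P [set w | p (G w)].
Proof. by rewrite fineK // fin_num_measure //; exact: measurable_graph_event. Qed.

Lemma pr_le p1 p2 : (forall w, p1 (G w) -> p2 (G w)) -> pr p1 <= pr p2.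
Proof.
move=> h; rewrite -lee_fin !prE; apply: le_measure => //; rewrite ?inE.
- exact: measurable_graph_event.
- exact: measurable_graph_event.
Qed.

Lemma pr_or p1 p2 : pr (fun g => p1 g \/ p2 g) <= pr p1 + pr p2.
Proof.
rewrite -lee_fin EFinD !prE.
by apply: measureU2; exact: measurable_graph_event.
Qed.

Lemma pr_ex N (p : nat -> fmgraph -> Prop) :
  pr (fun g => exists2 t, (t < N)%N & p t g) <= \sum_(t < N) pr (p t).
Proof.
elim: N => [|N IH].
  rewrite big_ord0 /pr (_ : [set w | _] = set0) ?measure0 //.
  by apply/seteqP; split=> // w [].
rewrite big_ord_recr /=; apply: le_trans (lerD IH (lexx _)).
apply: le_trans (pr_or _ _); apply: pr_le => w [t].
by rewrite ltnS leq_eqVlt => /orP[/eqP->|tN] pt; [right|left; exists t].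
Qed.

Lemma pr_markov (h : fmgraph -> R) (C a : R) : (forall g, 0 <= h g) -> 0 < a ->
  (\int[P]_w (h (G w))%:E <= C%:E)%E -> pr (fun g => a < h g) <= C / a.
Proof.
move=> h0 a0 hC; rewrite ler_pdivlMr // -lee_fin; apply: le_trans hC.
have mE : measurable [set w | a < h (G w)] by exact: (measurable_graph_event (fun g => a < h g)).
have mh : measurable_fun setT (fun w => (h (G w))%:E).
  apply/measurable_EFinP => _ Y mY; rewrite setTI.
  exact: (measurable_graph_event (fun g => Y (h g))).
rewrite mulrC EFinM prE -(integral_cst P mE).
have h1 : (\int[P]_(w in [set w | (a < h (G w))%R]) (cst a%:E w)
    <= \int[P]_(w in [set w | (a < h (G w))%R]) (h (G w))%:E)%E.
  apply: ge0_le_integral => //.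
  - by move=> w _; rewrite lee_fin ltW.
  - exact: measurable_funTS.
  - by move=> w /ltW; rewrite lee_fin.
by apply: le_trans h1 _; apply: ge0_subset_integral => // w _; rewrite lee_fin.
Qed.
End RandomGraphs.

(** A deviation by more than [eps] forces either a large average degree or the failure of one of
    finitely many tests, and a union bound applies. *)
Lemma tree_entropy_limit_rand (R : realType) (d : measure_display) (Omega : measurableType d)
    (P : probability Omega R) (G : nat -> Omega -> fmgraph) (rho : probability RG R) (C : R) :
  (forall n (g : fmgraph), measurable [set w | G n w = g]) ->
  (forall n w, loopless (G n w) /\ fconnected (G n w)) ->
  (forall n, (\int[P]_(w in [set: Omega]) (avg_deg (G n w) : R)%:E <= C%:E)%E) ->
  on_rooted_infinite rho -> rw_limit_rand P G rho ->
  forall eps : R, 0 < eps ->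
    fine (P [set w | (eps%:E < `|(ln (tau (G n w))%:R / (nv (G n w))%:R)%:E
      - tree_entropy rho|)%E]) @[n --> \oo] --> (0 : R).
Proof.
move=> mG Gok Gavg rhoW Glim eps eps0.
have avg0 (g : fmgraph) : 0 <= avg_deg g :> R by rewrite /avg_deg divr_ge0.
have C0 : 0 <= C.
  rewrite -lee_fin; apply: le_trans (Gavg 0%N).
  by apply: integral_ge0 => w _; rewrite lee_fin.
pose bad (g : fmgraph) : Prop :=
  (eps%:E < `|(ln (tau g)%:R / (nv g)%:R : R)%:E - tree_entropy rho|)%E.
apply/cvgrPdist_le => e e0.
(* Markov's inequality then leaves probability at most e/2 for an average degree above [C']; the
   other half is for the tests. *)
pose C' := 2 * (C + 1) / e.
have C'0 : 0 < C' by rewrite divr_gt0 ?mulr_gt0 //; lra.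
have CC' : C / C' <= e / 2.
  rewrite ler_pdivrMr //; have -> : e / 2 * C' = C + 1 by rewrite /C'; field; rewrite gt_eqF.
  by lra.
have [N NP] := tau_finitary rhoW C' eps0.
have tests : \sum_(t < N) pr P (G n) (fun g => N.+1%:R^-1 < test rho t g) @[n --> \oo]
    --> \sum_(t < N) (0 : R).
  apply: cvg_sumr => t _; rewrite /test.
  case: (unpickle t) => [[r H]|]; first by apply: Glim; rewrite ?invr_gt0.
  have z n : pr P (G n) (fun=> N.+1%:R^-1 < 0 :> R) = 0.
    rewrite /pr (_ : [set w | _] = set0) ?measure0 //.
    by apply/seteqP; split=> // w /=; rewrite ltNge invr_ge0 ler0n.
  by under eq_fun do rewrite z; exact: cvg_cst.
rewrite big1 // in tests; move/cvgrPdist_le: tests => /(_ (e / 2)).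
rewrite divr_gt0 // => /(_ isT); apply: filterS => n; rewrite sub0r normrN => hn.
rewrite sub0r normrN ger0_norm ?fine_ge0 // -[fine _]/(pr P (G n) bad).
apply: (@le_trans _ _ (pr P (G n) (fun g => C' < avg_deg g) +
    pr P (G n) (fun g => exists2 t, (t < N)%N & N.+1%:R^-1 < test rho t g))).
  apply: (@le_trans _ _ (pr P (G n) (fun g => C' < avg_deg g \/
      exists2 t, (t < N)%N & N.+1%:R^-1 < test rho t g))); last exact: pr_or.
  apply: pr_le; first exact: mG.
  move=> w bw; have [gl gc] := Gok n w; have [aC|] := leP (avg_deg (G n w)) C'; last by left.
  right; apply: contrapT => nt; apply: (NP _ gl gc aC _ bw) => t tN.
  by rewrite leNgt; apply/negP => ht; apply: nt; exists t.
have h1 := pr_markov (mG n) avg0 C'0 (Gavg n).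
have h2 := pr_ex P (mG n) N (fun t g => N.+1%:R^-1 < test rho t g).
have h3 := le_trans (ler_norm _) hn.
by apply: le_trans (lerD h1 h2) _; lra.
Qed.

Unset Implicit Arguments.

Theorem theorem3p3 (R : realType) :
  (* (i) deterministic graphs *)
  (forall (G : nat -> fmgraph) (rho : probability RG R),
     (forall n, loopless (G n) /\ fconnected (G n)) ->
     (exists C : R, forall n, avg_deg (G n) <= C) ->
     on_rooted_infinite rho ->
     rw_limit G rho ->
     (fun n => ((ln ((tau (G n))%:R : R) / (nv (G n))%:R)%:E)) @ \oo
       --> tree_entropy rho)
  /\
  (* (ii) random graphs, convergence in probability *)
  (forall (d : measure_display) (Omega : measurableType d)
          (P : probability Omega R) (G : nat -> Omega -> fmgraph)
          (rho : probability RG R),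
     (forall n (g : fmgraph), measurable [set w | G n w = g]) ->
     (forall n w, loopless (G n w) /\ fconnected (G n w)) ->
     (exists C : R, forall n,
        (\int[P]_(w in [set: Omega]) (avg_deg (G n w) : R)%:E <= C%:E)%E) ->
     on_rooted_infinite rho ->
     rw_limit_rand P G rho ->
     forall eps : R, 0 < eps ->
       (fun n => fine (P [set w | (eps%:E <
           `| ((ln ((tau (G n w))%:R : R) / (nv (G n w))%:R)%:E
              - tree_entropy rho)%E |)%E]))
         @ \oo --> (0 : R)).
Proof.
split=> [G rho Gok [C Gavg] rhoW Glim|d Omega P G rho mG Gok [C Gavg] rhoW Glim eps eps0].
  exact: tree_entropy_limit Gok Gavg rhoW Glim.
exact: tree_entropy_limit_rand mG Gok Gavg rhoW Glim eps eps0.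
Qed.
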